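(* Suppose that 1. $C[u]=C^0+C^1[u]\in\mathbb{R}^{n\times n}$ is linear in $u$; 2. the exact solution $v=v(t,x)$ of the initial boundary value problem is sufficiently smooth for $t\in(0,t_e]$, $t_e>0$; especially $\|V\|,\|V_t\|<\infty$; 3. $(m+1)\tau=t\in(0,t_e]$, $m\in\mathbb{N}$, $t$ fixed; 4. $\|U^j\|<\infty$, $j=1,\dots,m$; 5. $\|\eta^0\|=0$; 6. $\sup_{m\in\mathbb{N}}\big\{\|H^mH^{m-1}\cdots H^j\|,\ j=1,\dots,m\big\}<\infty$; 7. there is a positive constant $\delta_0<1$ such that, for $j=0,\dots,m$, $$\|G_0^{-1}\|\,\|G_1^j\|\le\Big(\max_{k\in[1,M-1]}\|G_{0k}^{-1}\|_n\Big)\frac1h\Big(\max_{k\in[1,M-1]}\|C^1[u_k^j]\|_n+\max_{k\in[1,M-2]}\|C[u_k^j]\|_n\Big)\le\delta_0 .$$ Then the global error $\eta^{m+1}=V^{m+1}-U^{m+1}$ has an upper bound that can be expressed in terms of norms containing $G_0^{-1}$ only: with a constant $K_1$, $$\|\eta^{m+1}\|\le\frac{K_1}{1-\delta_0}\,\frac t\tau\Big\{\max_{k\in[1,M-1]}\Big[\|G_{0k}^{-1}A\|_n\,O(\tau)+\|G_{0k}^{-1}B\|_n\,O(h^2)\Big]+\max_{j\in[1,m+1]}\Big(\|G_0^{-1}E_3^{j}\|\,O(h)+\|G_0^{-1}E_4^{j}\|\,\big(O(\tau)+O(\tau h)\big)\Big)\Big\}.$$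
   Context: Problem: consider the initial boundary value problem for the partial differential algebraic equation $Au_t+Bu_{xx}+C[u]u_x+Du=f(t,x)$, $t\in(0,t_e)$, $x\in(0,1)$, with $u$ valued in $\mathbb{R}^n$, given (consistent and compatible) initial values and zero Dirichlet boundary values at $x=0,1$. $A,B,D$ are constant real $(n,n)$-matrices, $A,B\neq0$, all matrices may be singular, and $f$ is sufficiently smooth. $C[u]=C^0+C^1[u]$, where $C^0$ is a constant matrix and $C^1[\cdot]$ is linear, so that $C[V]-C[U]=C^1[V-U]$. $C^0$ is chosen such that the matrices $G_{0k}$, $k=1,\dots,M-1$, defined below are regular (invertible). Discretization: the time step is $\tau$, $t_m=m\tau$, the space grid is $x_k=kh$, $k=0,\dots,M$, $h=1/M$. The numerical solution $u_k^m\in\mathbb{R}^n$ is defined, for $m=0,1,\dots$ and $k=1,\dots,M-1$, by $$A\frac{u_k^{m+1}-u_k^m}{\tau}+B\frac{u^{m+1}_{k-1}-2u^{m+1}_k+u^{m+1}_{k+1}}{h^2}+C[u_k^m]\frac{u^{m+1}_{k+1}-u^{m+1}_k}{h}+Du_k^{m+1}=f(t_{m+1},x_k),\qquad u_0^{m+1}=u_M^{m+1}=0,$$ with $u_k^0$ given by the initial values. Let $v_k^m:=v(t_m,x_k)$ for the exact solution $v$, and put $U^m:=(u_1^{mT},\dots,u_{M-1}^{mT})^T$, $V^m:=(v_1^{mT},\dots,v_{M-1}^{mT})^T$, $\eta^m:=V^m-U^m$; $V_t^m$ is the corresponding vector of values of $v_t$. Matrices: $I_{M-1}$ is the unit matrix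 of order $M-1$. $P\in\mathbb{R}^{(M-1)\times(M-1)}$ is tridiagonal with $-2$ on the diagonal and $1$ on both adjacent off-diagonals. $H_{M-1}\in\mathbb{R}^{(M-1)\times(M-1)}$ has ones on the first superdiagonal and zeros elsewhere, and $\tilde P:=-I_{M-1}+H_{M-1}$. For $S\in\mathbb{R}^{(M-1)\times(M-1)}$ and a matrix-valued map $E[\cdot]$, $S\otimes E[U^j]$ is the block matrix whose $(n,n)$-block at position $(i,k)$ is $S_{ik}E[u_i^j]$ (analogously with $V^j$); for a constant matrix $E$, $S\otimes E$ is the Kronecker product. Let $\lambda_k:=-\frac4{h^2}\sin^2\!\big(\frac{k\pi}{2M}\big)$, $k=1,\dots,M-1$, and $$G^j:=I_{M-1}\otimes\tfrac A\tau+\tfrac1{h^2}P\otimes B+\tfrac1h\tilde P\otimes C[U^j]+I_{M-1}\otimes D=G_0+G_1^j,$$ $$G_0:=I_{M-1}\otimes\big(\tfrac1\tau A-\tfrac1hC^0+D\big)+\tfrac1{h^2}P\otimes B,\qquad G_1^j:=\tfrac1h\big[H_{M-1}\otimes C^0+\tilde P\otimes C^1[U^j]\big],$$ $$G_{0k}:=\tfrac1\tau A-\tfrac1hC^0+D+\lambda_kB,\quad k=1,\dots,M-1,$$ $$E_1:=I_{M-1}\otimes A,\quad E_2:=I_{M-1}\otimes B,\quad E_3^{j}:=I_{M-1}\otimes C[V^{j}],\quad E_4^{j}:=I_{M-1}\otimes C^1[V_t^{j}].$$ $\tilde C[V^{m+1}]$ denotes the $(n(M-1),n(M-1))$-matrix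 with $\big(\tilde P\otimes C^1[w]\big)V^{m+1}=\tilde C[V^{m+1}]\,w$ for all $w\in\mathbb{R}^{n(M-1)}$, and $$H^m:=(G^m)^{-1}\Big(I_{M-1}\otimes\tfrac A\tau-\tfrac1h\tilde C[V^{m+1}]\Big).$$ Norms: for $w\in\mathbb{R}^{n(M-1)}$, $\|w\|:=\big[h\sum_{k=1}^{n(M-1)}w_k^2\big]^{1/2}$, and $\|\cdot\|$ on matrices of order $n(M-1)$ is the induced operator norm. $\|\cdot\|_n$ is the spectral norm of real $(n,n)$-matrices. Conventions: the limit considered is $\tau\to0$, $h\to0$ with $t$ fixed. In condition 6 (a stability condition) the supremum is taken along this refinement, with $0<m\tau\in(0,t_e]$, possibly under a restriction of the step sizes of the form $\kappa_0\le\tau/h\le\kappa_1$ or $\kappa_2\le\tau/h^2\le\kappa_3$. The $O(\cdot)$ terms are nonnegative quantities bounded by a constant (independent of $\tau$, $h$ and the time index) times the argument. They are norms of the vector terms in the truncation error of the scheme, $\mathcal{A}^{j+1}=E_1O(\tau)+E_2O(h^2)+E_3^{j+1}O(h)+E_4^{j+1}[O(\tau h)+O(\tau)]$, which is obtained by inserting the exact solution into the scheme and Taylor expanding in lowest order with respect to $\tau$ and $h$. *)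

(* Defs.v *)
(* The index (i, k) |-> i * n + k of the Kronecker product *t (mxtens) makes
   the i-th block of an (M-1)n-vector its i-th run of n entries. *)
From mathcomp Require Import all_boot all_order all_algebra.
From mathcomp Require Import all_classical all_reals all_analysis.
From mathcomp Require Import mxtens ring.
Set Implicit Arguments.
Unset Strict Implicit.
Unset Printing Implicit Defensive.
Import Order.TTheory GRing.Theory Num.Theory.
Import numFieldNormedType.Exports.
Local Open Scope classical_set_scope.
Local Open Scope ring_scope.

Section Norms.
Variable R : realType.

(* The weight h is the mesh width for grid vectors and 1 for R^n. *)
Definition hnorm (h : R) p (w : 'cV[R]_p) : R :=
  Num.sqrt (h * \sum_k w k ord0 ^+ 2).

Definition opnorm (h : R) p (Q : 'M[R]_p) : R :=
  sup [set hnorm h (Q *m w) | w in [set w | hnorm h w <= 1]].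

Definition specnorm p (Q : 'M[R]_p) : R := opnorm 1 Q.

End Norms.

Section Grid.
Variables (R : realType) (n : nat).

Definition mesh (M : nat) : R := M%:R^-1.

Definition on_grid (tau : R) (M : nat) (g : R -> R -> 'cV[R]_n) :
    nat -> nat -> 'cV[R]_n :=
  fun j k => g (j%:R * tau) (k%:R * mesh M).

(* Only the interior values w 1, ..., w (M-1) of a grid function are kept. *)
Definition stack (M : nat) (w : nat -> 'cV[R]_n) : 'cV[R]_(M.-1 * n) :=
  \col_a w (mxtens_unindex a).1.+1 (mxtens_unindex a).2 ord0.

Definition blk N (w : 'cV[R]_(N * n)) (i : 'I_N) : 'cV[R]_n :=
  \col_k w (mxtens_index (i, k)) ord0.

Lemma blkE N (w : 'cV[R]_(N * n)) i :
  blk w i = \sum_b w b ord0 *: blk (delta_mx b ord0) i.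
Proof.
apply/matrixP => k j; rewrite !mxE summxE.
rewrite (bigD1 (mxtens_index (i, k))) //= big1 ?addr0 => [|b neq_b].
  by rewrite !mxE !eqxx mulr1.
by rewrite !mxE eq_sym (negPf neq_b) mulr0.
Qed.

(* S (x) E[w]: the (n,n)-block at position (i,k) is S_ik E[w_i]. *)
Definition btens N (S : 'M[R]_N) (E : 'cV[R]_n -> 'M[R]_n)
    (w : 'cV[R]_(N * n)) : 'M[R]_(N * n) :=
  \matrix_(a, b) (S (mxtens_unindex a).1 (mxtens_unindex b).1 *
    E (blk w (mxtens_unindex a).1) (mxtens_unindex a).2 (mxtens_unindex b).2).

Definition lapP N : 'M[R]_N :=
  \matrix_(i, k) (if i == k then -2
                  else if (i.+1 == k :> nat) || (k.+1 == i :> nat) then 1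
                  else 0).

Definition supH N : 'M[R]_N := \matrix_(i, k) (i.+1 == k :> nat)%:R.

Definition tilP N : 'M[R]_N := - 1%:M + supH N.

Definition lambda (M k : nat) : R :=
  - (4 / mesh M ^+ 2) * sin (k%:R * pi / (2 * M%:R)) ^+ 2.

End Grid.

Section Scheme.
Variables (R : realType) (n : nat).
Variables (A B C0 D : 'M[R]_n) (C1 : {linear 'cV[R]_n -> 'M[R]_n}).

Definition Cof (w : 'cV[R]_n) : 'M[R]_n := C0 + C1 w.

Definition scheme (f : R -> R -> 'cV[R]_n) (tau : R) (M : nat)
    (u : nat -> nat -> 'cV[R]_n) (j k : nat) : Prop :=
  let h := mesh R M in
  A *m (tau^-1 *: (u j.+1 k - u j k))
  + B *m (h ^- 2 *: (u j.+1 k.-1 - 2 *: u j.+1 k + u j.+1 k.+1))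
  + Cof (u j k) *m (h^-1 *: (u j.+1 k.+1 - u j.+1 k))
  + D *m u j.+1 k = on_grid tau M f j.+1 k.

Section Matrices.
Variables (tau : R) (M : nat).
Local Notation h := (mesh R M).
Local Notation N := M.-1.
Implicit Types U V W : 'cV[R]_(N * n).

Definition Gmx U : 'M[R]_(N * n) :=
  1%:M *t (tau^-1 *: A) + h ^- 2 *: (lapP R N *t B)
  + h^-1 *: btens (tilP R N) Cof U + 1%:M *t D.

Definition G0mx : 'M[R]_(N * n) :=
  1%:M *t (tau^-1 *: A - h^-1 *: C0 + D) + h ^- 2 *: (lapP R N *t B).

Definition G1mx U : 'M[R]_(N * n) :=
  h^-1 *: (supH R N *t C0 + btens (tilP R N) C1 U).

Definition G0k (k : nat) : 'M[R]_n :=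
  tau^-1 *: A - h^-1 *: C0 + D + lambda R M k *: B.

Definition E3mx V : 'M[R]_(N * n) := btens 1%:M Cof V.
Definition E4mx V : 'M[R]_(N * n) := btens 1%:M C1 V.

(* The matrix of the linear map w |-> (tilP (x) C1[w]) W (CtilE): column b is
   the image of the b-th unit vector. *)
Definition Ctil W : 'M[R]_(N * n) :=
  \matrix_(a, b) (btens (tilP R N) C1 (delta_mx b ord0) *m W) a ord0.

(* H^j, with U = U^j and W = V^(j+1). *)
Definition Hmx U W : 'M[R]_(N * n) :=
  invmx (Gmx U) *m (1%:M *t (tau^-1 *: A) - h^-1 *: Ctil W).

Lemma GmxE U : Gmx U = G0mx + G1mx U.
Proof. by apply/matrixP => a b; rewrite !mxE; ring. Qed.

Lemma CtilE W w : btens (tilP R N) C1 w *m W = Ctil W *m w.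
Proof.
apply/matrixP => a j; rewrite ord1 mxE [RHS]mxE.
under [RHS]eq_bigr => b _ do rewrite mxE mxE mulr_suml.
rewrite exchange_big /=; apply: eq_bigr => c _.
rewrite mxE blkE linear_sum summxE mulr_sumr mulr_suml.
by apply: eq_bigr => b _; rewrite linearZ /= !mxE; ring.
Qed.

End Matrices.

(* o and a are indexed by the step-size pairs of a refinement: one constant
   serves the whole refinement, not only its tail. *)
Definition isO (o a : nat -> R) : Prop :=
  exists c : R, forall i, 0 <= o i <= c * a i.

(* dg a b is the partial derivative d_t^a d_x^b g: for a + b <= r it exists in
   the open rectangle and extends to a continuous bounded function on
   ]0, te] x [0, 1]; in particular dg 1 0 gives the values of g_t at t = te. *)
Definition smooth_upto (r : nat) (te : R) (g : R -> R -> 'cV[R]_n)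
    (dg : nat -> nat -> R -> R -> 'cV[R]_n) : Prop :=
  let Q := [set p : R * R | (0 < p.1 <= te) && (0 <= p.2 <= 1)] in
  [/\ forall p, Q p -> dg 0 0 p.1 p.2 = g p.1 p.2,
      forall a b, (a + b <= r)%N ->
        {within Q, continuous (fun p : R * R => dg a b p.1 p.2)},
      forall a b, (a + b <= r)%N ->
        exists K : R, forall p, Q p -> `|dg a b p.1 p.2| <= K
    & forall a b, (a + b < r)%N -> forall s x, 0 < s < te -> 0 < x < 1 ->
        is_derive s 1 (fun s' => dg a b s' x) (dg a.+1 b s x) /\
        is_derive x 1 (fun x' => dg a b s x') (dg a b.+1 s x)].

Definition solves_ibvp (te : R) (f : R -> R -> 'cV[R]_n) (phi : R -> 'cV[R]_n)
    (v : R -> R -> 'cV[R]_n) (dv : nat -> nat -> R -> R -> 'cV[R]_n) : Prop :=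
  [/\ forall s x, 0 < s < te -> 0 < x < 1 ->
        A *m dv 1 0 s x + B *m dv 0 2 s x + Cof (v s x) *m dv 0 1 s x
        + D *m v s x = f s x,
      forall s, 0 < s < te -> v s 0 = 0 /\ v s 1 = 0,
      forall x, 0 <= x <= 1 -> v 0 x = phi x
    & {within [set p : R * R | (0 <= p.1 <= te) && (0 <= p.2 <= 1)],
        continuous (fun p : R * R => v p.1 p.2)}].

End Scheme.

(* Main.v *)
(* Inserting the exact solution into the scheme gives
     G^j eta^{j+1} = (I (x) A/tau - Ctil/h) eta^j + r^j,
   so eta^{m+1} is the sum of the H^m ... H^{j+1} (G^j)^-1 r^j; condition 6
   bounds the products and condition 7 gives |(G^j)^-1 r| <= |G_0^-1 r|/(1-delta0)
   by a Neumann series.  With v+ = v(t_{j+1}), w = v+ - v(t_j),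
     r^j = A[w/tau - v_t] + B[D^2 v+ - v_xx] + C[v+](D v+ - v_x) - C1[w] D v+,
   and the first three terms are estimated by Taylor expansion; the discrete sine
   transform diagonalizes G_0, whence |G_0^-1 (I (x) Q)| = max_k |G_0k^-1 Q|.

   The last term is not C1[tau v_t] D v+: the remainder C1[O(tau^2)] has to be
   bounded by G_0^-1 E_4 as well, although G_0^-1 may be unbounded.  All
   increments w lie in the span of finitely many values b_r of v_t, with
   coordinates of size O(tau), and |G_0k^-1 C1[b_r]| is at most a constant times
   max_j |G_0^-1 E_4^j| on fine grids: near the point where v_t = b_r some grid
   interval carries a fixed share of the mass of every sine vector. *)
Require Import Defs.
From mathcomp Require Import all_boot all_order all_algebra.
From mathcomp Require Import all_classical all_reals all_analysis.
From mathcomp Require Import mxtens ring lra zify.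
Set Implicit Arguments.
Unset Strict Implicit.
Unset Printing Implicit Defensive.
Import Order.TTheory GRing.Theory Num.Theory.
Import numFieldNormedType.Exports.
Local Open Scope classical_set_scope.
Local Open Scope ring_scope.

(** * Norms and the discrete Duhamel formula *)

Section EuclideanNorms.
Variable R : realType.
Implicit Types h c : R.

(** No residual term may be estimated by |G_0^-1| |r|: a factor A, B, E_3 or C1[.] has to stay
    directly to the right of G_0^-1, and the Neumann step has to compare the vectors (G^j)^-1 r and
    G_0^-1 r instead of operator norms. The sine transform reduces G_0^-1 to the G_0k^-1 only
    against factors whose block is the same at every node. The increments w vary with the node;
    expansion in the fixed b_r splits C1[w] into constant blocks C1[b_r] and scalar coefficients.
    The reverse comparison, from G_0k^-1 C1[b_r] to G_0^-1 E_4, is by testing: in the transpose,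
    G_0^-T meets the sine vector first and acts there as G_0k^-T, and the node-dependent blocks come
    last. Its constant must not depend on the frequency, so the mass of a sine vector is compared by
    a recurrence whose coefficient 2 cos is bounded by 2 at all frequencies. At time 0 only
    continuity of v is known, so time expansions are centred at t_{j+1} and the b_r are taken at
    interior points. The constants are fixed before [delta0] and have to serve every grid of the
    refinement. *)

Definition sqn p (w : 'cV[R]_p) : R := \sum_k w k ord0 ^+ 2.

Lemma sqn_ge0 p (w : 'cV[R]_p) : 0 <= sqn w.
Proof. by apply: sumr_ge0 => k _; exact: sqr_ge0. Qed.

Lemma sqn_eq0 p (w : 'cV[R]_p) : (sqn w == 0) = (w == 0).
Proof.
apply/idP/eqP => [|->]; last by rewrite /sqn big1 // => k _; rewrite mxE expr0n.
rewrite psumr_eq0 => [/allP w0|k _]; last exact: sqr_ge0.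
apply/matrixP => k j; rewrite ord1 mxE.
by have := w0 k (mem_index_enum _); rewrite /= sqrf_eq0 => /eqP.
Qed.

Lemma sqnZ p c (w : 'cV[R]_p) : sqn (c *: w) = c ^+ 2 * sqn w.
Proof. by rewrite /sqn mulr_sumr; apply: eq_bigr => k _; rewrite mxE exprMn. Qed.

Lemma sum_CauchySchwarz (I : finType) (a b : I -> R) :
  (\sum_i a i * b i) ^+ 2 <= (\sum_i a i ^+ 2) * (\sum_i b i ^+ 2).
Proof.
set X := \sum_i a i ^+ 2; set Y := \sum_i b i ^+ 2; set Z := \sum_i a i * b i.
have Y0 : 0 <= Y by apply: sumr_ge0 => i _; exact: sqr_ge0.
have [Yp|] := ltP 0 Y; last first.
  move=> Yle; have /eqP Yeq : Y == 0 by rewrite eq_le Yle Y0.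
  suff -> : Z = 0 by rewrite Yeq expr0n mulr0.
  move/eqP: Yeq; rewrite psumr_eq0 => [/allP b0|i _]; last exact: sqr_ge0.
  rewrite /Z big1 // => i _.
  have := b0 i (mem_index_enum _); rewrite /= sqrf_eq0 => /eqP ->.
  by rewrite mulr0.
have : 0 <= \sum_i (Y * a i - Z * b i) ^+ 2.
  by apply: sumr_ge0 => i _; exact: sqr_ge0.
have -> : \sum_i (Y * a i - Z * b i) ^+ 2
    = Y ^+ 2 * X - 2 * Y * Z * Z + Z ^+ 2 * Y.
  transitivity (\sum_i (Y ^+ 2 * a i ^+ 2 - 2 * Y * Z * (a i * b i)
      + Z ^+ 2 * b i ^+ 2)); first by apply: eq_bigr => i _; ring.
  by rewrite big_split /= sumrB -!mulr_sumr.
have -> : Y ^+ 2 * X - 2 * Y * Z * Z + Z ^+ 2 * Y = Y * (X * Y - Z ^+ 2) by ring.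
by rewrite pmulr_rge0 // subr_ge0.
Qed.

Lemma hnorm_sqn h p (w : 'cV[R]_p) : hnorm h w = Num.sqrt (h * sqn w).
Proof. by []. Qed.

Lemma hnormE h p (w : 'cV[R]_p) : 0 <= h -> hnorm h w = Num.sqrt h * hnorm 1 w.
Proof. by move=> h0; rewrite /hnorm mul1r sqrtrM. Qed.

Lemma hnorm_ge0 h p (w : 'cV[R]_p) : 0 <= hnorm h w.
Proof. exact: sqrtr_ge0. Qed.

Lemma hnorm1_sqr p (w : 'cV[R]_p) : hnorm 1 w ^+ 2 = sqn w.
Proof. by rewrite /hnorm mul1r sqr_sqrtr // sqn_ge0. Qed.

Lemma hnorm0 h p : hnorm h (0 : 'cV[R]_p) = 0.
Proof.
have /eqP s0 : sqn (0 : 'cV[R]_p) == 0 by rewrite sqn_eq0.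
by rewrite hnorm_sqn s0 mulr0 sqrtr0.
Qed.

Lemma hnorm_eq0 h p (w : 'cV[R]_p) : 0 < h -> (hnorm h w == 0) = (w == 0).
Proof.
move=> h0; rewrite -sqn_eq0 hnorm_sqn sqrtr_eq0 pmulr_rle0 //.
by rewrite eq_le sqn_ge0 andbT.
Qed.

Lemma hnormZ h p c (w : 'cV[R]_p) : 0 <= h -> hnorm h (c *: w) = `|c| * hnorm h w.
Proof.
move=> h0; rewrite !hnorm_sqn sqnZ mulrCA sqrtrM ?sqr_ge0 //.
by rewrite sqrtr_sqr.
Qed.

Lemma hnormN h p (w : 'cV[R]_p) : hnorm h (- w) = hnorm h w.
Proof.
by rewrite /hnorm; under eq_bigr => k _ do rewrite mxE sqrrN.
Qed.

Lemma hnorm1D p (u w : 'cV[R]_p) : hnorm 1 (u + w) <= hnorm 1 u + hnorm 1 w.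
Proof.
rewrite -ler_sqr ?nnegrE ?addr_ge0 ?hnorm_ge0 // sqrrD !hnorm1_sqr.
have -> : sqn (u + w) = sqn u + (\sum_k u k ord0 * w k ord0) *+ 2 + sqn w.
  rewrite /sqn -sumrMnl -!big_split /=; apply: eq_bigr => k _.
  by rewrite mxE sqrrD.
rewrite lerD2r lerD2l lerMn2r /=; apply: le_trans (ler_norm _) _.
rewrite -ler_sqr ?nnegrE ?mulr_ge0 ?hnorm_ge0 // real_normK ?num_real //.
by rewrite exprMn !hnorm1_sqr sum_CauchySchwarz.
Qed.

Lemma hnormD h p (u w : 'cV[R]_p) :
  0 <= h -> hnorm h (u + w) <= hnorm h u + hnorm h w.
Proof.
move=> h0; rewrite !(hnormE _ h0) -mulrDr ler_wpM2l ?sqrtr_ge0 //.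
exact: hnorm1D.
Qed.

Lemma hnorm_sum h p (I : Type) (r : seq I) (P : pred I) (F : I -> 'cV[R]_p) :
  0 <= h -> hnorm h (\sum_(i <- r | P i) F i) <= \sum_(i <- r | P i) hnorm h (F i).
Proof.
move=> h0; elim/big_rec2: _ => [|i y1 y2 _ IH]; first by rewrite hnorm0.
by apply: le_trans (hnormD _ _ h0) _; rewrite lerD2l.
Qed.

Lemma dot_le_hnorm p (u w : 'cV[R]_p) : (u^T *m w) ord0 ord0 <= hnorm 1 u * hnorm 1 w.
Proof.
apply: le_trans (ler_norm _) _.
rewrite -ler_sqr ?nnegrE ?mulr_ge0 ?hnorm_ge0 // real_normK ?num_real //.
rewrite exprMn !hnorm1_sqr mxE.
by under eq_bigr => k _ do rewrite mxE; exact: sum_CauchySchwarz.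
Qed.

Lemma dot_sqn p (u : 'cV[R]_p) : (u^T *m u) ord0 ord0 = sqn u.
Proof. by rewrite mxE; apply: eq_bigr => k _; rewrite mxE expr2. Qed.

Lemma sqn_mulmx_le p (Q : 'M[R]_p) w :
  sqn (Q *m w) <= (\sum_i \sum_j Q i j ^+ 2) * sqn w.
Proof.
rewrite /sqn mulr_suml; apply: ler_sum => i _; rewrite mxE.
exact: sum_CauchySchwarz.
Qed.

(** The Frobenius norm is an upper bound. Boundedness makes the [sup] in [opnorm] a genuine supremum
    and not a default value. *)
Lemma opnorm_ubound h p (Q : 'M[R]_p) : 0 < h ->
  has_ubound [set hnorm h (Q *m w) | w in [set w | hnorm h w <= 1]].
Proof.
move=> h0; exists (Num.sqrt (\sum_i \sum_j Q i j ^+ 2)) => _ [w /= w1 <-].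
have S0 : 0 <= \sum_i \sum_j Q i j ^+ 2.
  by apply: sumr_ge0 => i _; apply: sumr_ge0 => j _; exact: sqr_ge0.
rewrite -[leRHS]mulr1; apply: le_trans (ler_wpM2l (sqrtr_ge0 _) w1).
rewrite !hnorm_sqn -sqrtrM // ler_wsqrtr // mulrCA ler_pM2l //.
exact: sqn_mulmx_le.
Qed.

Lemma opnorm_ge0 h p (Q : 'M[R]_p) : 0 < h -> 0 <= opnorm h Q.
Proof.
move=> h0; apply: le_trans (ub_le_sup (opnorm_ubound Q h0) _).
  exact: (hnorm_ge0 h (Q *m 0)).
by exists 0 => //=; rewrite hnorm0.
Qed.

Lemma hnorm_mulmx_le h p (Q : 'M[R]_p) w :
  0 < h -> hnorm h (Q *m w) <= opnorm h Q * hnorm h w.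
Proof.
move=> h0; have [->|w0] := eqVneq w 0; first by rewrite mulmx0 !hnorm0 mulr0.
have wp : 0 < hnorm h w by rewrite lt_def hnorm_ge0 hnorm_eq0 // w0.
rewrite -ler_pdivrMr // mulrC.
have -> : (hnorm h w)^-1 * hnorm h (Q *m w) = hnorm h (Q *m ((hnorm h w)^-1 *: w)).
  by rewrite -scalemxAr hnormZ ?(ltW h0) // ger0_norm // invr_ge0 ltW.
apply: (ub_le_sup (opnorm_ubound Q h0)); exists ((hnorm h w)^-1 *: w) => //=.
rewrite hnormZ ?(ltW h0) // ger0_norm; first by rewrite mulVf // gt_eqF.
by rewrite invr_ge0 ltW.
Qed.

Lemma opnorm_le h p (Q : 'M[R]_p) c : 0 <= c ->
  (forall w, hnorm h (Q *m w) <= c * hnorm h w) -> opnorm h Q <= c.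
Proof.
move=> c0 Qc; apply: ge_sup.
  by exists (hnorm h (Q *m 0)); exists 0 => //=; rewrite hnorm0.
by move=> _ [w /= w1 <-]; apply: le_trans (Qc w) _; rewrite ler_piMr.
Qed.

(** The weight contributes the factor sqrt h on both sides and cancels. Operator norms can be
    computed with weight 1; [h] matters only for vectors. *)
Lemma opnorm_mesh h p (Q : 'M[R]_p) : 0 < h -> opnorm h Q = opnorm 1 Q.
Proof.
move=> h0; apply/eqP; rewrite eq_le; apply/andP; split.
  apply: opnorm_le; first exact: opnorm_ge0.
  move=> w; rewrite !(hnormE _ (ltW h0)) mulrCA ler_wpM2l ?sqrtr_ge0 //.
  exact: hnorm_mulmx_le.
apply: opnorm_le; first exact: opnorm_ge0.
move=> w; have := hnorm_mulmx_le Q w h0; rewrite !(hnormE _ (ltW h0)) mulrCA.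
by rewrite ler_pM2l // sqrtr_gt0.
Qed.

Lemma opnorm1_le h p : opnorm h (1%:M : 'M[R]_p) <= 1.
Proof. by apply: opnorm_le => // w; rewrite mul1mx mul1r. Qed.

Lemma opnorm_eq0 h p (Q : 'M[R]_p) : 0 < h -> opnorm h Q = 0 -> Q = 0.
Proof.
move=> h0 Q0; apply/matrixP => i j; rewrite mxE.
have : hnorm h (Q *m delta_mx j ord0) <= 0.
  by apply: le_trans (hnorm_mulmx_le _ _ h0) _; rewrite Q0 mul0r.
rewrite le_eqVlt ltNge hnorm_ge0 orbF hnorm_eq0 // => /eqP/matrixP/(_ i ord0).
by rewrite -colE !mxE.
Qed.

(** Duality: for z = Q^T w one has |z|^2 = <w, Q z> <= |w| |Q| |z|, and |z| is cancelled. *)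
Lemma hnorm_tr_mulmx_le p (Q : 'M[R]_p) w :
  hnorm 1 (Q^T *m w) <= opnorm 1 Q * hnorm 1 w.
Proof.
have [->|z0] := eqVneq (Q^T *m w) 0.
  by rewrite hnorm0 mulr_ge0 ?opnorm_ge0 ?hnorm_ge0.
set z := Q^T *m w in z0 *.
have zp : 0 < hnorm 1 z by rewrite lt_def hnorm_ge0 hnorm_eq0 // z0.
rewrite -(ler_pM2r zp) -expr2 hnorm1_sqr -dot_sqn {1}/z trmx_mul trmxK -mulmxA.
apply: le_trans (dot_le_hnorm _ _) _.
by rewrite mulrAC mulrC ler_wpM2r ?hnorm_ge0 // hnorm_mulmx_le.
Qed.

Lemma opnorm_tr_le p (Q : 'M[R]_p) c : 0 <= c ->
  (forall w, hnorm 1 (Q^T *m w) <= c * hnorm 1 w) -> opnorm 1 Q <= c.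
Proof.
move=> c0 Qc; have le_tr : opnorm 1 Q^T <= c by exact: opnorm_le.
apply: le_trans le_tr; apply: opnorm_le; first exact: opnorm_ge0.
by move=> w; rewrite -{1}[Q]trmxK; exact: hnorm_tr_mulmx_le.
Qed.

Lemma unitmx_ker0 p (Q : 'M[R]_p) :
  (forall w : 'cV[R]_p, Q *m w = 0 -> w = 0) -> Q \in unitmx.
Proof.
move=> Q0; rewrite -unitmx_tr -row_free_unit -kermx_eq0.
apply/eqP/row_matrixP => i; rewrite row0.
have := Q0 (row i (kermx Q^T))^T; rewrite -[Q in Q *m _]trmxK -trmx_mul.
rewrite -row_mul mulmx_ker row0 trmx0 => /(_ erefl) /(congr1 trmx).
by rewrite trmxK trmx0.
Qed.

(** No series is summed: a kernel vector satisfies w = - X^-1 Y w, hence |w| <= d |w| and w = 0. *)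
Lemma neumann_unit h p (X Y : 'M[R]_p) (d : R) : 0 < h -> d < 1 ->
  X \in unitmx -> opnorm h (invmx X) * opnorm h Y <= d -> X + Y \in unitmx.
Proof.
move=> h0 d1 Xu XY; apply: unitmx_ker0 => w Gw; apply/eqP.
rewrite -(hnorm_eq0 _ h0) eq_le hnorm_ge0 andbT.
have -> : w = - (invmx X *m (Y *m w)).
  apply/eqP; rewrite -addr_eq0; apply/eqP.
  by rewrite -[X in X + _](mulKmx Xu) -mulmxDr -mulmxDl Gw mulmx0.
rewrite hnormN; set z := hnorm _ (_ *m _).
have zE : z = hnorm h w.
  rewrite /z -hnormN; congr hnorm; apply/eqP; rewrite eq_sym -addr_eq0; apply/eqP.
  by rewrite -[X in X + _](mulKmx Xu) -mulmxDr -mulmxDl Gw mulmx0.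
have : z <= d * z.
  rewrite {2}zE; apply: le_trans (ler_wpM2r (hnorm_ge0 _ _) XY).
  rewrite -mulrA; apply: le_trans (hnorm_mulmx_le _ _ h0) _.
  by rewrite ler_wpM2l ?opnorm_ge0 // hnorm_mulmx_le.
by rewrite -subr_le0 -{1}[z]mul1r -mulrBl pmulr_rle0 // subr_gt0.
Qed.

(** With z = (X + Y)^-1 w, the vector X^-1 w = z + X^-1 Y z has norm at least (1 - d) |z|. Keeping
    X^-1 w as a vector preserves the factors of [w] that tame X^-1. *)
Lemma neumann_inv h p (X Y : 'M[R]_p) (d : R) w : 0 < h -> d < 1 ->
  X \in unitmx -> opnorm h (invmx X) * opnorm h Y <= d ->
  hnorm h (invmx (X + Y) *m w) <= hnorm h (invmx X *m w) / (1 - d).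
Proof.
move=> h0 d1 Xu XY; have XYu := neumann_unit h0 d1 Xu XY.
set z := invmx (X + Y) *m w.
rewrite ler_pdivlMr ?subr_gt0 // mulrBr mulr1 lerBlDr.
have -> : invmx X *m w = z + invmx X *m (Y *m z).
  by rewrite -[X in X + _](mulKmx Xu) -mulmxDr -mulmxDl mulKVmx.
rewrite -[z in leLHS](addrK (invmx X *m (Y *m z))).
apply: le_trans (hnormD _ _ (ltW h0)) _; rewrite lerD2l hnormN.
rewrite mulrC; apply: le_trans (ler_wpM2r (hnorm_ge0 _ _) XY).
rewrite -mulrA; apply: le_trans (hnorm_mulmx_le _ _ h0) _.
by rewrite ler_wpM2l ?opnorm_ge0 // hnorm_mulmx_le.
Qed.

(** Variation of constants. [rev] places the latest factor on the left, H (q-1) ... H (j+1); the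
    product is empty for j = q - 1. *)
Lemma duhamel p q (H : nat -> 'M[R]_p) (e r : nat -> 'cV[R]_p) :
  e 0%N = 0 -> (forall j, (j < q)%N -> e j.+1 = H j *m e j + r j) ->
  e q = \sum_(0 <= j < q)
    (\big[mulmx/1%:M]_(l <- rev (index_iota j.+1 q)) H l) *m r j.
Proof.
move=> e0; elim: q => [|q IH] eS; first by rewrite big_geq.
rewrite eS // big_nat_recr //= IH => [|j jq]; last by apply: eS; exact: ltnW.
congr (_ + _); last by rewrite /index_iota subnn big_nil mul1mx.
rewrite mulmx_sumr; apply: eq_big_nat => j /andP[_ jq].
have -> : index_iota j.+1 q.+1 = rcons (index_iota j.+1 q) q.
  by rewrite /index_iota subSn // -[(_ - _).+1]addn1 iotaD /= subnKC // cats1.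
by rewrite rev_rcons big_cons mulmxA.
Qed.

End EuclideanNorms.

(** * The sine transform and the diagonalization of G_0 *)

Section SineSums.
Variable R : realType.
Implicit Types x y : R.

(** This three-term recurrence yields both the eigenvectors of [lapP] and the comparison of masses
    of neighbouring blocks. *)
Lemma sin_add2n x y : sin (x + y + y) = 2 * cos y * sin (x + y) - sin x.
Proof.
rewrite [sin (x + y + y)]sinD.
have -> : sin x = sin (x + y) * cos y - cos (x + y) * sin y by rewrite -sinB addrK.
by ring.
Qed.

Lemma sum_sin2_period x (M k : nat) : (0 < k < M)%N ->
  \sum_(0 <= l < M) sin (x + l%:R * (k%:R * pi / M%:R)) ^+ 2 = M%:R / 2.
Proof.
move=> /andP[k0 kM]; set t := k%:R * pi / M%:R.
have M0 : 0 < M%:R :> R by rewrite ltr0n (leq_trans _ kM).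
have t_gt0 : 0 < sin t.
  apply: sin_gt0_pi; apply/andP; split.
    by rewrite divr_gt0 // mulr_gt0 ?pi_gt0 ?ltr0n.
  by rewrite ltr_pdivrMr // mulrC ltr_pM2l ?pi_gt0 // ltr_nat.
(* [g] is a discrete primitive: g (l+1) - g l = 2 sin t cos (2 (x + l t)), so the cosine sum
   telescopes; g M = g 0 because 2 M t is a multiple of 2 pi. *)
pose g (l : nat) := sin (2 * x - t + l%:R * (2 * t)).
have gM : g M = g 0%N.
  rewrite /g mul0r addr0.
  have -> : M%:R * (2 * t) = (pi *+ 2) *+ k.
    by rewrite /t -mulr_natr -[_ *+ k]mulr_natr; field; rewrite gt_eqF.
  exact: (periodicn (@sinD2pi R)).
have cos0 : \sum_(0 <= l < M) cos (2 * (x + l%:R * t)) = 0.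
  apply: (mulfI (lt0r_neq0 t_gt0)); rewrite mulr0.
  suff -> : sin t * \sum_(0 <= l < M) cos (2 * (x + l%:R * t))
      = 2^-1 * (g M - g 0%N) by rewrite gM subrr mulr0.
  rewrite -telescope_sumr // !mulr_sumr; apply: eq_bigr => l _.
  rewrite /g.
  have -> : 2 * x - t + l.+1%:R * (2 * t) = 2 * (x + l%:R * t) + t.
    by rewrite -natr1; ring.
  have -> : 2 * x - t + l%:R * (2 * t) = 2 * (x + l%:R * t) - t by ring.
  by rewrite sinD sinB; field.
have -> : M%:R / 2 = \sum_(0 <= l < M) 2^-1
    - 2^-1 * \sum_(0 <= l < M) cos (2 * (x + l%:R * t)) :> R.
  by rewrite cos0 mulr0 subr0 sumr_const_nat subn0 mulr_natl.
rewrite mulr_sumr -sumrB; apply: eq_bigr => l _.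
rewrite [2 * (_ + _)]mulr_natl cos_mulr2n cos2sin2 -mulr_natr.
by field.
Qed.

(* Cut the integers into blocks of length p: the three-term recurrence of
   sin bounds the mass of each block by that of the two preceding ones, so the
   first two blocks control the mass M/2 of a whole period. *)
Lemma sum_sin2_interval (M k a p Q : nat) : (0 < k < M)%N -> (M <= Q * p)%N ->
  M%:R / 2 <= Q%:R * 11 ^+ Q *
    \sum_(a <= l < a + p + p) sin (l%:R * (k%:R * pi / M%:R) : R) ^+ 2.
Proof.
move=> kM MQ; set t := k%:R * pi / M%:R.
pose s (l : nat) := sin (l%:R * t).
pose T j := \sum_(0 <= l < p) s (a + j * p + l)%N ^+ 2.
have T0 j : 0 <= T j by apply: sumr_ge0 => l _; exact: sqr_ge0.
(* The recurrence with stride p reads u = 2 z - v with |z| <= |w|, so u^2 <= 8 w^2 + 2 v^2 <= 10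
   (v^2 + w^2), whatever the frequency. *)
have T2 j : T j.+2 <= 10 * (T j + T j.+1).
  rewrite /T -big_split mulr_sumr; apply: ler_sum => l _ /=.
  set u := s _; set v := s _; set w := s _.
  have -> : u = 2 * cos (p%:R * t) * w - v.
    rewrite /u /v /w /s.
    have -> : (a + j.+2 * p + l)%N = (a + j * p + l + p + p)%N by lia.
    have -> : (a + j.+1 * p + l)%N = (a + j * p + l + p)%N by lia.
    by rewrite !(natrD _ _ p) !(mulrDl _ p%:R) sin_add2n.
  have c1 : cos (p%:R * t) ^+ 2 <= 1 by rewrite cos2sin2 lerBlDr lerDl sqr_ge0.
  have : (cos (p%:R * t) * w) ^+ 2 <= w ^+ 2.
    by rewrite exprMn ler_piMl ?sqr_ge0.
  set z := cos _ * w => zw.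
  have -> : 2 * cos (p%:R * t) * w = 2 * z by rewrite /z; ring.
  by have := sqr_ge0 (2 * z + v); nra.
(* Adding T (j+1) to the bound 10 (T j + T (j+1)) of T (j+2) gives the ratio 11. *)
have TT j : T j + T j.+1 <= 11 ^+ j * (T 0%N + T 1%N).
  elim: j => [|j IH]; first by rewrite expr0 mul1r.
  rewrite exprS -mulrA.
  have -> : T j.+1 + T j.+2 = T j.+2 + T j.+1 by rewrite addrC.
  by have := T2 j; have := T0 j; lra.
have block q : \sum_(0 <= l < q * p) s (a + l)%N ^+ 2 = \sum_(0 <= j < q) T j.
  elim: q => [|q IH]; first by rewrite mul0n !big_geq.
  rewrite big_nat_recr //= -IH mulSn addnC.
  rewrite (big_cat_nat (n := (q * p)%N)) ?leq_addr //=; congr (_ + _).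
  rewrite -{1}[(q * p)%N]add0n big_addn addKn /T.
  by apply: eq_bigr => l _; rewrite [(l + _)%N]addnC addnA.
have -> : \sum_(a <= l < a + p + p) s l ^+ 2 = T 0%N + T 1%N.
  rewrite (big_cat_nat (n := (a + p)%N)) ?leq_addr //=.
  rewrite -{1}[a]add0n big_addn addKn -{1}[(a + p)%N]add0n big_addn addKn.
  by congr (_ + _); apply: eq_bigr => l _; rewrite ?mul0n ?mul1n ?addn0 addnC.
have <- : \sum_(0 <= l < M) s (a + l)%N ^+ 2 = M%:R / 2.
  rewrite -(sum_sin2_period (a%:R * t) kM); apply: eq_bigr => l _.
  by rewrite /s natrD mulrDl.
apply: (@le_trans _ _ (\sum_(0 <= l < Q * p) s (a + l)%N ^+ 2)).
  rewrite (big_cat_nat (leq0n M) MQ) /= lerDl.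
  by apply: sumr_ge0 => l _; exact: sqr_ge0.
rewrite block.
apply: (@le_trans _ _ (\sum_(0 <= j < Q) 11 ^+ Q * (T 0%N + T 1%N))).
  rewrite !big_nat; apply: ler_sum => j /andP[_ jQ].
  apply: (@le_trans _ _ (T j + T j.+1)); first by rewrite lerDl.
  apply: le_trans (TT j) _; rewrite ler_wpM2r ?addr_ge0 //.
  by rewrite ler_eXn2l ?ltr1n // ltnW.
by rewrite sumr_const_nat subn0 -[_ *+ Q]mulr_natl mulrA.
Qed.

End SineSums.

(** * Block vectors, block matrices and difference stencils *)

Section BlockMatrices.
Variables (R : realType) (n : nat).

Lemma sum_mxtens N (V : nmodType) (f : 'I_(N * n) -> V) :
  \sum_b f b = \sum_i \sum_k f (mxtens_index (i, k)).
Proof.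
rewrite pair_big /= (reindex (@mxtens_index N n)) /=.
  by apply: eq_bigr => -[i k] _.
exists (@mxtens_unindex N n) => b _; [exact: mxtens_indexK|exact: mxtens_unindexK].
Qed.

Lemma blk_inj N (u w : 'cV[R]_(N * n)) : (forall i, blk u i = blk w i) -> u = w.
Proof.
move=> uw; apply/matrixP => b j; rewrite ord1 -[b]mxtens_unindexK.
case: (mxtens_unindex b) => i k.
by have /matrixP/(_ k ord0) := uw i; rewrite !mxE.
Qed.

Lemma sqn_blk N (w : 'cV[R]_(N * n)) : sqn w = \sum_i sqn (blk w i).
Proof.
rewrite /sqn sum_mxtens; apply: eq_bigr => i _; apply: eq_bigr => k _.
by rewrite mxE.
Qed.

Lemma blkD N (u w : 'cV[R]_(N * n)) i : blk (u + w) i = blk u i + blk w i.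
Proof. by apply/matrixP => k j; rewrite !mxE. Qed.

Lemma blkN N (w : 'cV[R]_(N * n)) i : blk (- w) i = - blk w i.
Proof. by apply/matrixP => k j; rewrite !mxE. Qed.

Lemma blkZ N c (w : 'cV[R]_(N * n)) i : blk (c *: w) i = c *: blk w i.
Proof. by apply/matrixP => k j; rewrite !mxE. Qed.

Lemma blk_stack M (w : nat -> 'cV[R]_n) i : blk (stack M w) i = w i.+1.
Proof.
by apply/matrixP => k j; rewrite !mxE mxtens_indexK [j]ord1.
Qed.

Lemma blk_btens N (S : 'M[R]_N) E (u w : 'cV[R]_(N * n)) i :
  blk (btens S E u *m w) i = \sum_k S i k *: (E (blk u i) *m blk w k).
Proof.
apply/matrixP => a j; rewrite mxE mxE sum_mxtens summxE.
apply: eq_bigr => k _; rewrite 2!mxE mulr_sumr; apply: eq_bigr => b _.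
by rewrite !mxE !mxtens_indexK /= mulrA.
Qed.

Lemma blk_tens N (S : 'M[R]_N) (Q : 'M[R]_n) (w : 'cV[R]_(N * n)) i :
  blk ((S *t Q) *m w) i = \sum_k S i k *: (Q *m blk w k).
Proof.
apply/matrixP => a j; rewrite mxE mxE sum_mxtens summxE.
apply: eq_bigr => k _; rewrite 2!mxE mulr_sumr; apply: eq_bigr => b _.
by rewrite !mxE !mxtens_indexK /= mulrA.
Qed.

(** Blocks may depend on the node: this is the common form of [1%:M *t Q] and [btens 1%:M E w],
    hence of E_1 to E_4. *)
Definition bdiag N (F : 'I_N -> 'M[R]_n) : 'M[R]_(N * n) :=
  \matrix_(a, b) (((mxtens_unindex a).1 == (mxtens_unindex b).1)%:R *
    F (mxtens_unindex a).1 (mxtens_unindex a).2 (mxtens_unindex b).2).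

Lemma blk_bdiag N (F : 'I_N -> 'M[R]_n) w i :
  blk (bdiag F *m w) i = F i *m blk w i.
Proof.
apply/matrixP => a j; rewrite mxE mxE sum_mxtens (bigD1 i) //= addrC big1.
  rewrite add0r mxE; apply: eq_bigr => b _.
  by rewrite !mxE !mxtens_indexK /= eqxx mul1r.
move=> k /negPf ki; rewrite big1 // => b _.
by rewrite !mxE !mxtens_indexK /= eq_sym ki !mul0r.
Qed.

Lemma mulmx_ext p (X Y : 'M[R]_p) : (forall w : 'cV[R]_p, X *m w = Y *m w) -> X = Y.
Proof.
move=> XY; apply/matrixP => i j.
by have /matrixP/(_ i ord0) := XY (delta_mx j ord0); rewrite -!colE !mxE.
Qed.

Lemma btens1E N E (w : 'cV[R]_(N * n)) :
  btens 1%:M E w = bdiag (fun i => E (blk w i)).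
Proof. by apply/matrixP => a b; rewrite !mxE. Qed.

Lemma tens1E N (Q : 'M[R]_n) : (1%:M : 'M[R]_N) *t Q = bdiag (fun _ => Q).
Proof. by apply/matrixP => a b; rewrite !mxE. Qed.

Lemma bdiagM N (F1 F2 : 'I_N -> 'M[R]_n) :
  bdiag F1 *m bdiag F2 = bdiag (fun i => F1 i *m F2 i).
Proof.
apply: mulmx_ext => w; apply: blk_inj => i.
by rewrite -mulmxA !blk_bdiag mulmxA.
Qed.

Lemma opnorm_bdiag_le N (F : 'I_N -> 'M[R]_n) (c : R) : 0 <= c ->
  (forall i, opnorm 1 (F i) <= c) -> opnorm 1 (bdiag F) <= c.
Proof.
move=> c0 Fc; apply: opnorm_le => // w.
rewrite -ler_sqr ?nnegrE ?mulr_ge0 ?hnorm_ge0 // exprMn !hnorm1_sqr.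
rewrite !sqn_blk mulr_sumr; apply: ler_sum => i _.
rewrite blk_bdiag -!hnorm1_sqr -exprMn ler_sqr ?nnegrE ?mulr_ge0 ?hnorm_ge0 //.
apply: le_trans (hnorm_mulmx_le _ _ ltr01) _.
by rewrite ler_wpM2r ?hnorm_ge0.
Qed.

(** The two zeros stand for the neighbours missing from the first and last row of [lapP]. Values lie
    in any module, because the stencil is applied to scalar sine vectors and to grid functions in
    R^n. *)
Lemma lapP_sum N (V : lmodType R) (g : nat -> V) (i : 'I_N) :
  g 0%N = 0 -> g N.+1 = 0 ->
  \sum_(l < N) lapP R N i l *: g l.+1 = g i - 2 *: g i.+1 + g i.+2.
Proof.
move=> g0 gN.
have delta m (f : nat -> V) :
    \sum_(l < N) (l == m :> nat)%:R *: f l = if (m < N)%N then f m else 0.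
  case: ltnP => [mN|Nm].
    rewrite (bigD1 (Ordinal mN)) //= eqxx scale1r big1 ?addr0 // => l.
    by rewrite -val_eqE /= => /negPf ->; rewrite scale0r.
  rewrite big1 // => l _; case: eqVneq => [lm|_]; last by rewrite scale0r.
  by have := ltn_ord l; rewrite lm ltnNge Nm.
have lapE (l : 'I_N) : lapP R N i l *: g l.+1 =
    - 2 *: ((l == i :> nat)%:R *: g l.+1) + ((l == i.+1 :> nat)%:R *: g l.+1)
    + (l.+1 == i :> nat)%:R *: g l.+1.
  rewrite mxE -val_eqE /= [i.+1 == _]eq_sym [(i : nat) == _]eq_sym.
  case: (eqVneq (l : nat) i) => [->|li].
    by rewrite eqn_leq ltnn andbF gtn_eqF //= !scale0r !addr0 scale1r.
  rewrite scale0r scaler0 add0r.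
  case: (eqVneq (l : nat) i.+1) => [->|li1] /=.
    by rewrite gtn_eqF // scale0r addr0.
  by case: eqVneq; rewrite ?scale0r add0r.
under eq_bigr => l _ do rewrite lapE.
rewrite !big_split /= -scaler_sumr !(delta _ (fun l => g l.+1)) ltn_ord.
have -> : (if (i.+1 < N)%N then g i.+2 else 0) = g i.+2.
  case: ltnP => // Ni; have -> : i.+2 = N.+1 by have := ltn_ord i; lia.
  by rewrite gN.
have -> : \sum_(l < N) (l.+1 == i :> nat)%:R *: g l.+1 = g i.
  case: i {lapE} => -[|i] iN /=; first by rewrite big1 // => l _; rewrite scale0r.
  by under eq_bigr => l _ do rewrite eqSS; rewrite (delta i (fun l => g l.+1)) ltnW.
by rewrite scaleNr addrC addrA.
Qed.

Lemma tilP_sum N (V : lmodType R) (g : nat -> V) (i : 'I_N) : g N.+1 = 0 ->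
  \sum_(l < N) tilP R N i l *: g l.+1 = g i.+2 - g i.+1.
Proof.
move=> gN.
under eq_bigr => l _ do rewrite 4!mxE scalerDl scaleNr.
rewrite big_split /= sumrN addrC; congr (_ - _).
  have [iN|Ni] := ltnP i.+1 N.
    rewrite (bigD1 (Ordinal iN)) //= eqxx scale1r big1 ?addr0 // => l.
    by rewrite -val_eqE /= eq_sym => /negPf ->; rewrite scale0r.
  have -> : i.+2 = N.+1 by have := ltn_ord i; lia.
  rewrite gN big1 // => l _; rewrite gtn_eqF ?scale0r //.
  exact: leq_trans (ltn_ord l) Ni.
rewrite (bigD1 i) //= eqxx scale1r big1 ?addr0 // => l.
by rewrite eq_sym => /negPf ->; rewrite scale0r.
Qed.

End BlockMatrices.

Section SineTransform.
Variables (R : realType) (N : nat).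

(** The discrete sine transform, with N + 1 = M. The factor normalizes the columns; symmetric and
    orthogonal, the matrix is its own inverse. *)
Definition sine_mx : 'M[R]_N :=
  \matrix_(i, k) (Num.sqrt (2 / N.+1%:R) *
    sin (i.+1%:R * (k.+1%:R * pi / N.+1%:R))).

Lemma sine_mx_tr : sine_mx^T = sine_mx.
Proof.
apply/matrixP => i k; rewrite !mxE; congr (_ * sin _).
by rewrite !mulrA [_%:R * _%:R]mulrC.
Qed.

Lemma sine_mx_sqr (k : 'I_N) : \sum_i sine_mx i k ^+ 2 = 1.
Proof.
have N0 : 0 < N.+1%:R :> R by rewrite ltr0n.
pose f (l : nat) := sin (0 + l%:R * (k.+1%:R * pi / N.+1%:R)) ^+ 2 : R.
have kN : (0 < k.+1 < N.+1)%N by exact: ltn_ord k.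
have := sum_sin2_period (0 : R) kN; rewrite big_mkord -/f => sumf.
transitivity (2 / N.+1%:R * \sum_(l < N.+1) f l); last by rewrite sumf; field; rewrite gt_eqF.
rewrite big_ord_recl /f mul0r addr0 sin0 expr0n add0r mulr_sumr.
apply: eq_bigr => i _; rewrite mxE exprMn sqr_sqrtr ?divr_ge0 1?ltW //.
by rewrite add0r.
Qed.

Lemma lapP_sine_mx i k : \sum_l lapP R N i l * sine_mx l k =
  - 4 * sin (k.+1%:R * pi / (2 * N.+1%:R)) ^+ 2 * sine_mx i k.
Proof.
have N0 : N.+1%:R != 0 :> R by rewrite pnatr_eq0.
pose t : R := k.+1%:R * pi / N.+1%:R.
have tE : k.+1%:R * pi / (2 * N.+1%:R) = t / 2 :> R by rewrite /t; field.
pose g (l : nat) : R^o := Num.sqrt (2 / N.+1%:R) * sin (l%:R * t).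
have g0 : g 0%N = 0 by rewrite /g mul0r sin0 mulr0.
have gN : g N.+1 = 0.
  rewrite /g; have -> : N.+1%:R * t = 0 + pi *+ k.+1.
    by rewrite add0r -mulr_natr /t; field.
  by rewrite (alternatingn (@sinDpi R)) sin0 !mulr0.
have := lapP_sum i g0 gN.
under eq_bigr => l _.
  have -> : lapP R N i l *: g l.+1 = lapP R N i l * sine_mx l k by rewrite [sine_mx _ _]mxE.
  over.
move=> ->; rewrite mxE -/t tE /g.
have -> : i.+2%:R * t = i%:R * t + t + t by rewrite -addn2 natrD; ring.
have -> : i.+1%:R * t = i%:R * t + t by rewrite -addn1 natrD; ring.
rewrite sin_add2n.
have -> : cos t = 1 - 2 * sin (t / 2) ^+ 2.
  have {1}-> : t = (t / 2) *+ 2 by rewrite -mulr_natr; field.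
  by rewrite cos_mulr2n cos2sin2 -mulr_natr; ring.
rewrite /GRing.scale /=; ring.
Qed.

(** The columns are eigenvectors of the symmetric [lapP]. Their eigenvalues [mu] are distinct
    because cos is injective on [0, pi], so different columns are orthogonal. *)
Lemma sine_mx_orthonormal : sine_mx *m sine_mx = 1%:M.
Proof.
have N0 : 0 < N.+1%:R :> R by rewrite ltr0n.
pose mu (k : 'I_N) : R := - 4 * sin (k.+1%:R * pi / (2 * N.+1%:R)) ^+ 2.
have mu_inj : injective mu.
  move=> k l; rewrite /mu => kl.
  have cosE (j : 'I_N) : cos (j.+1%:R * pi / N.+1%:R)
      = 1 - 2 * sin (j.+1%:R * pi / (2 * N.+1%:R)) ^+ 2 :> R.
    have -> : j.+1%:R * pi / N.+1%:R = (j.+1%:R * pi / (2 * N.+1%:R)) *+ 2 :> R.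
      by rewrite -[_ *+ 2]mulr_natr; field; rewrite gt_eqF.
    by rewrite cos_mulr2n cos2sin2 -[_ *+ 2]mulr_natr; ring.
  have itv (j : 'I_N) : j.+1%:R * pi / N.+1%:R \in `[0, pi : R].
    rewrite in_itv /=; apply/andP; split; first by rewrite divr_ge0 // mulr_ge0 ?pi_ge0.
    by rewrite ler_pdivrMr // mulrC ler_pM2l ?pi_gt0 // ler_nat ltnW // ltnS ltn_ord.
  have : cos (k.+1%:R * pi / N.+1%:R) = cos (l.+1%:R * pi / N.+1%:R) :> R.
    by rewrite !cosE; lra.
  move/(cos_inj (itv k) (itv l))/(divIf (lt0r_neq0 N0))/(mulIf (lt0r_neq0 (pi_gt0 R))).
  by move/eqP; rewrite eqr_nat eqSS => /eqP/val_inj.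
have symP i l : lapP R N i l = lapP R N l i by rewrite !mxE eq_sym orbC.
apply/matrixP => i k; rewrite !mxE.
have -> : \sum_j sine_mx i j * sine_mx j k = \sum_j sine_mx j i * sine_mx j k.
  by apply: eq_bigr => j _; congr (_ * _); rewrite -[in LHS]sine_mx_tr mxE.
case: eqVneq => [->|ik].
  by under eq_bigr => j _ do rewrite -expr2; exact: sine_mx_sqr.
apply: (mulfI (_ : mu i - mu k != 0)).
  by rewrite subr_eq0 (inj_eq mu_inj).
rewrite mulr0 mulrBl !mulr_sumr.
have -> : \sum_j mu i * (sine_mx j i * sine_mx j k)
    = \sum_j \sum_l lapP R N j l * sine_mx l i * sine_mx j k.
  by apply: eq_bigr => j _; rewrite -mulr_suml lapP_sine_mx mulrA.
have -> : \sum_j mu k * (sine_mx j i * sine_mx j k)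
    = \sum_j \sum_l lapP R N j l * sine_mx l k * sine_mx j i.
  apply: eq_bigr => j _; rewrite -mulr_suml lapP_sine_mx.
  by rewrite /mu; ring.
rewrite exchange_big /= -sumrB big1 // => j _.
by rewrite -sumrB big1 // => l _; rewrite symP; ring.
Qed.

End SineTransform.

Section BlockDiagonalization.
Variables (R : realType) (n N : nat) (A B C0 D : 'M[R]_n) (tau : R).
Local Notation S := (sine_mx R N *t (1%:M : 'M[R]_n)).
Local Notation G0 := (G0mx A B C0 D tau N.+1 : 'M[R]_(N * n)).
Local Notation Gk k := (G0k A B C0 D tau N.+1 k).
Hypothesis Gk_unit : forall k, (1 <= k < N.+1)%N -> Gk k \in unitmx.

Let SS : S *m S = 1%:M.
Proof.
rewrite tensmx_mul sine_mx_orthonormal mul1mx.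
by apply: mulmx_ext => w; apply: blk_inj => i; rewrite tens1E blk_bdiag !mul1mx.
Qed.

Let St : S^T = S.
Proof. by rewrite trmx_tens sine_mx_tr trmx1. Qed.

Let S_isom (w : 'cV[R]_(N * n)) : hnorm 1 (S *m w) = hnorm 1 w.
Proof.
by rewrite /hnorm -!/(sqn _) -!dot_sqn trmx_mul St mulmxA -(mulmxA w^T) SS mulmx1.
Qed.

(** The first tensor factors in G_0 are the identity and [lapP] only; on the sine vector of
    frequency k the latter acts as h^2 lambda_k, which leaves exactly G_0k. *)
Lemma G0mx_diag : G0 *m S = S *m bdiag (fun k : 'I_N => Gk k.+1).
Proof.
have lapS : lapP R N *m sine_mx R N
    = \matrix_(i, k) (- 4 * sin (k.+1%:R * pi / (2 * N.+1%:R)) ^+ 2 * sine_mx R N i k).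
  by apply/matrixP => i k; rewrite [LHS]mxE [RHS]mxE lapP_sine_mx.
apply: mulmx_ext => w; apply: blk_inj => i.
rewrite -!mulmxA [in RHS]blk_tens.
under [RHS]eq_bigr => k _ do rewrite blk_bdiag mul1mx.
rewrite mulmxA mulmxDl -scalemxAl !tensmx_mul lapS mul1mx !mulmx1.
rewrite mulmxDl -scalemxAl blkD blkZ !blk_tens scaler_sumr -big_split /=.
apply: eq_bigr => k _; rewrite /G0k.
rewrite [in RHS](mulmxDl _ (lambda _ _ _ *: _)) scalerDr; congr (_ + _).
rewrite -scalemxAl !scalerA; congr (_ *: _).
by rewrite [X in _ * X]mxE /lambda; ring.
Qed.

Lemma G0mx_inv : G0 \in unitmx /\
  invmx G0 = S *m bdiag (fun k : 'I_N => invmx (Gk k.+1)) *m S.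
Proof.
set F := bdiag _.
have GF : G0 *m (S *m F *m S) = 1%:M.
  rewrite !mulmxA G0mx_diag -(mulmxA S) bdiagM.
  rewrite (_ : bdiag _ = 1%:M) ?mulmx1 //.
  apply: mulmx_ext => w; apply: blk_inj => i.
  by rewrite blk_bdiag mulmxV ?mul1mx //; apply: Gk_unit; exact: ltn_ord i.
have [Gu _] := mulmx1_unit GF; split=> //.
by rewrite -[RHS](mulKmx Gu) GF mulmx1.
Qed.

(** A block [Q] that is the same at all nodes commutes with the isometry [S], so the product is
    block diagonal in the sine basis. *)
Lemma opnorm_invG0_tens (Q : 'M[R]_n) (c : R) : 0 <= c ->
  (forall k, (1 <= k < N.+1)%N -> opnorm 1 (invmx (Gk k) *m Q) <= c) ->
  opnorm 1 (invmx G0 *m (1%:M *t Q)) <= c.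
Proof.
move=> c0 Qc; have [_ ->] := G0mx_inv.
have -> : S *m bdiag (fun k : 'I_N => invmx (Gk k.+1)) *m S *m (1%:M *t Q)
    = S *m bdiag (fun k : 'I_N => invmx (Gk k.+1) *m Q) *m S.
  rewrite -!mulmxA; congr (_ *m _).
  rewrite (_ : S *m (1%:M *t Q) = (1%:M *t Q) *m S); last first.
    by rewrite !tensmx_mul !mulmx1 !mul1mx.
  by rewrite mulmxA tens1E bdiagM.
apply: opnorm_le => // w; rewrite -!mulmxA S_isom -(S_isom w).
apply: le_trans (hnorm_mulmx_le _ _ ltr01) _.
rewrite ler_wpM2r ?hnorm_ge0 // opnorm_bdiag_le // => i.
by apply: Qc; exact: ltn_ord i.
Qed.

(* The transposed operator is applied to the vector with blocks S_ik y. *)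
Lemma invG0_bdiag_lower (X : 'I_N -> 'M[R]_n) (k : 'I_N) (y : 'cV[R]_n) :
  \sum_i sine_mx R N i k ^+ 2 * sqn ((X i)^T *m ((invmx (Gk k.+1))^T *m y))
    <= opnorm 1 (invmx G0 *m bdiag X) ^+ 2 * sqn y.
Proof.
have bdT (F : 'I_N -> 'M[R]_n) : (bdiag F)^T = bdiag (fun i => (F i)^T).
  by apply/matrixP => a b; rewrite !mxE eq_sym; case: eqVneq => [->|]; rewrite ?mul0r.
pose w : 'cV[R]_(N * n) :=
  \col_a (((mxtens_unindex a).1 == k)%:R * y (mxtens_unindex a).2 ord0).
have bw i : blk w i = (i == k)%:R *: y.
  by apply/matrixP => a j; rewrite !mxE mxtens_indexK [j]ord1.
have wy : sqn w = sqn y.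
  rewrite sqn_blk (bigD1 k) //= big1 ?addr0 ?bw ?eqxx ?scale1r // => i /negPf ik.
  by rewrite bw ik scale0r; apply/eqP; rewrite sqn_eq0.
have := hnorm_tr_mulmx_le (invmx G0 *m bdiag X) (S *m w).
rewrite S_isom -ler_sqr ?nnegrE ?mulr_ge0 ?opnorm_ge0 ?hnorm_ge0 //.
rewrite exprMn !hnorm1_sqr wy; apply: le_trans.
rewrite le_eqVlt; apply/orP; left; apply/eqP.
have [_ ->] := G0mx_inv.
rewrite !trmx_mul St !bdT !mulmxA -(mulmxA _ S S) SS mulmx1 sqn_blk.
apply: eq_bigr => i _; rewrite -sqnZ; congr sqn.
rewrite -!mulmxA blk_bdiag blk_tens (bigD1 k) //= big1 ?addr0 => [|l /negPf lk].
  by rewrite mul1mx blk_bdiag bw eqxx scale1r -!scalemxAr.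
by rewrite mul1mx blk_bdiag bw lk scale0r mulmx0 scaler0.
Qed.

End BlockDiagonalization.

(** * Taylor estimates up to the boundary *)

Section TaylorBounds.
Variables (R : realType) (a b : R).
Implicit Types (F g : R -> R) (x z K : R).
Local Notation inI x := (a < x < b).

(** Mean value theorem: the intermediate point is no farther from x than z is. The factor 1 / (p +
    1) of an integration is given away; iteration yields Taylor remainders. *)
Lemma growth_bound F F' x z K p : 0 <= K -> inI x -> inI z -> F x = 0 ->
  (forall y, inI y -> is_derive y 1 F (F' y)) ->
  (forall y, inI y -> `|F' y| <= K * `|y - x| ^+ p) ->
  `|F z| <= K * `|z - x| ^+ p.+1.
Proof.
move=> K0 /andP[ax xb] /andP[az zb] Fx dF bF.
have cF c d : a < c -> d < b -> {within `[c, d], continuous F}.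
  move=> ac db; apply: derivable_within_continuous => y.
  rewrite in_itv /= => /andP[cy yd].
  have yI : inI y by rewrite (lt_le_trans ac cy) (le_lt_trans yd db).
  by have [] := dF y yI.
have step y : inI y -> `|y - x| <= `|z - x| ->
    `|F' y| * `|z - x| <= K * `|z - x| ^+ p.+1.
  move=> yI yz; rewrite exprSr mulrA ler_wpM2r // (le_trans (bF _ yI)) //.
  by rewrite ler_wpM2l // lerXn2r ?nnegrE.
case: (ltgtP x z) => [xz|zx|<-]; last by rewrite Fx subrr normr0 expr0n mulr0.
- have [y|y /[!in_itv]/= /andP[xy yz]] := MVT xz (df := F') _ (cF _ _ ax zb).
    by rewrite in_itv /= => /andP[xy yz]; apply: dF; rewrite (lt_trans ax) ?(lt_trans yz).
  rewrite Fx subr0 => ->; rewrite normrM; apply: step.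
    by rewrite (lt_trans ax) ?(lt_trans yz).
  by rewrite !gtr0_norm ?subr_gt0 // lerD2r ltW.
- have [y|y /[!in_itv]/= /andP[zy yx]] := MVT zx (df := F') _ (cF _ _ az xb).
    by rewrite in_itv /= => /andP[zy yx]; apply: dF; rewrite (lt_trans az) ?(lt_trans yx).
  rewrite Fx sub0r => Fz; rewrite -normrN Fz normrM [`|x - z|]distrC; apply: step.
    by rewrite (lt_trans az) ?(lt_trans yx).
  by rewrite !ltr0_norm ?subr_lt0 // !opprB lerD2l lerN2 ltW.
Qed.

Let is_derive_cubic (c0 c1 c2 c3 x y : R) : is_derive y 1
  (fun z => c0 + c1 * (z - x) + c2 * (z - x) ^+ 2 + c3 * (z - x) ^+ 3)
  (c1 + 2 * c2 * (y - x) + 3 * c3 * (y - x) ^+ 2).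
Proof.
pose q : {poly R} := c0%:P + ('X - x%:P) * (c1%:P + ('X - x%:P) *
  (c2%:P + ('X - x%:P) * c3%:P)).
have -> : (fun z => c0 + c1 * (z - x) + c2 * (z - x) ^+ 2 + c3 * (z - x) ^+ 3)
    = horner q.
  apply/funext => z /=.
  by rewrite /q !(hornerD, hornerM, hornerN, hornerX, hornerC); ring.
have -> : c1 + 2 * c2 * (y - x) + 3 * c3 * (y - x) ^+ 2 = (deriv q).[y].
  rewrite /q !(derivD, derivN, derivM, derivC, derivX) -?[1]/(1%:P).
  by rewrite !(horner0, hornerD, hornerM, hornerN, hornerX, hornerC); ring.
exact: is_derive_poly.
Qed.

Section Orders.
Variables g g1 g2 g3 g4 : R -> R.
Variable K : R.
Hypothesis K0 : 0 <= K.
Hypothesis dg : forall y, inI y -> is_derive y 1 g (g1 y).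

Lemma lipschitz_bound x z : inI x -> inI z ->
  (forall y, inI y -> `|g1 y| <= K) -> `|g z - g x| <= K * `|z - x|.
Proof.
move=> xI zI bg; have := @growth_bound (fun y => g y - g x) g1 x z K 0.
rewrite expr1; apply => //; first by rewrite subrr.
  move=> y yI; rewrite -[g1 y]subr0.
  exact: (is_deriveB (dg yI) (is_derive_cst (g x) y 1)).
by move=> y yI; rewrite expr0 mulr1 bg.
Qed.

Let is_derive_sub_cubic f f1 (c0 c1 c2 c3 x : R) :
  (forall y, inI y -> is_derive y 1 f (f1 y)) ->
  forall y, inI y -> is_derive y 1
   (fun z => f z - (c0 + c1 * (z - x) + c2 * (z - x) ^+ 2 + c3 * (z - x) ^+ 3))
   (f1 y - (c1 + 2 * c2 * (y - x) + 3 * c3 * (y - x) ^+ 2)).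
Proof.
by move=> df y yI; exact: (is_deriveB (df y yI) (is_derive_cubic c0 c1 c2 c3 x y)).
Qed.

Hypothesis dg1 : forall y, inI y -> is_derive y 1 g1 (g2 y).

Lemma taylor2_bound x z : inI x -> inI z ->
  (forall y, inI y -> `|g2 y| <= K) ->
  `|g z - g x - (z - x) * g1 x| <= K * `|z - x| ^+ 2.
Proof.
move=> xI zI bg.
have b1 y : inI y -> `|g1 y - (g1 x + 2 * 0 * (y - x) + 3 * 0 * (y - x) ^+ 2)|
    <= K * `|y - x| ^+ 1.
  move=> yI; have := growth_bound (p := 0) K0 xI yI _
    (is_derive_sub_cubic (g1 x) 0 0 0 x dg1).
  rewrite /= !mulr0 !mul0r !addr0 subrr => /(_ erefl); apply => w wI.
  by rewrite !mul0r !addr0 subr0 expr0 mulr1 bg.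
have := growth_bound K0 xI zI _ (is_derive_sub_cubic (g x) (g1 x) 0 0 x dg) b1.
rewrite /= subrr !mulr0 expr0n !mulr0 !mul0r !addr0 subrr opprD addrA mulrC.
exact.
Qed.

Hypothesis dg2 : forall y, inI y -> is_derive y 1 g2 (g3 y).
Hypothesis dg3 : forall y, inI y -> is_derive y 1 g3 (g4 y).

(** Differentiating a Taylor remainder gives the remainder of the derivative, one order lower;
    [growth_bound] is applied four times, starting at [g3]. *)
Lemma taylor4_bound x z : inI x -> inI z ->
  (forall y, inI y -> `|g4 y| <= K) ->
  `|g z - g x - (z - x) * g1 x - (z - x) ^+ 2 * (g2 x / 2)
     - (z - x) ^+ 3 * (g3 x / 6)| <= K * `|z - x| ^+ 4.
Proof.
move=> xI zI bg.
have b3 y : inI y -> `|g3 y - (g3 x + 2 * 0 * (y - x) + 3 * 0 * (y - x) ^+ 2)|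
    <= K * `|y - x| ^+ 1.
  move=> yI; have := growth_bound (p := 0) K0 xI yI _
    (is_derive_sub_cubic (g3 x) 0 0 0 x dg3).
  rewrite /= !mulr0 !mul0r !addr0 subrr => /(_ erefl); apply => w wI.
  by rewrite !mul0r !addr0 subr0 expr0 mulr1 bg.
have at_x (f : R -> R) c1 c2 c3 : f x - (f x + c1 * (x - x) + c2 * (x - x) ^+ 2
    + c3 * (x - x) ^+ 3) = 0.
  by rewrite subrr; ring.
have b2 y (yI : inI y) := growth_bound K0 xI yI (at_x g2 (g3 x) 0 0)
    (is_derive_sub_cubic (g2 x) (g3 x) 0 0 x dg2) b3.
have b1 y : inI y -> `|g1 y - (g1 x + g2 x * (y - x) + (g3 x / 2) * (y - x) ^+ 2
    + 0 * (y - x) ^+ 3)| <= K * `|y - x| ^+ 3.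
  move=> yI; apply: (growth_bound K0 xI yI (at_x g1 _ _ _)
    (is_derive_sub_cubic (g1 x) (g2 x) (g3 x / 2) 0 x dg1)) => w wI.
  by apply: le_trans (b2 w wI); rewrite le_eqVlt; apply/orP; left; apply/eqP;
    congr (`| _ |); field.
have := growth_bound K0 xI zI (at_x g (g1 x) (g2 x / 2) (g3 x / 6))
    (is_derive_sub_cubic (g x) (g1 x) (g2 x / 2) (g3 x / 6) x dg).
move=> /(_ 3%N) le4; apply: le_trans (le4 _).
  by rewrite le_eqVlt; apply/orP; left; apply/eqP; congr (`| _ |); ring.
move=> w wI; apply: le_trans (b1 w wI).
by rewrite le_eqVlt; apply/orP; left; apply/eqP; congr (`| _ |); field.
Qed.

(** Adding the expansions at x + y and x - y cancels the odd orders and leaves two fourth-order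
    remainders. *)
Lemma central_diff_bound x y : inI x -> inI (x - y) -> inI (x + y) ->
  (forall w, inI w -> `|g4 w| <= K) ->
  `|g (x - y) - 2 * g x + g (x + y) - y ^+ 2 * g2 x| <= 2 * K * `|y| ^+ 4.
Proof.
move=> xI mI pI bg.
have := taylor4_bound xI mI bg; have := taylor4_bound xI pI bg.
rewrite [x + y - x]addrAC subrr add0r [x - y - x]addrAC subrr add0r normrN.
set Tp := `| _ |; set Tm := `| _ | => Tp4 Tm4.
have -> : g (x - y) - 2 * g x + g (x + y) - y ^+ 2 * g2 x =
  (g (x + y) - g x - y * g1 x - y ^+ 2 * (g2 x / 2) - y ^+ 3 * (g3 x / 6)) +
  (g (x - y) - g x - (- y) * g1 x - (- y) ^+ 2 * (g2 x / 2)
    - (- y) ^+ 3 * (g3 x / 6)) by field.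
apply: le_trans (ler_normD _ _) _; rewrite -/Tp -/Tm; lra.
Qed.

End Orders.
End TaylorBounds.

(** * Limits, and passage from the open to the closed rectangle *)

Section MatrixLimits.
Variable R : realType.

Lemma cvg_sumr (I : Type) (r : seq I) (F : I -> nat -> R) (l : I -> R) :
  (forall i, F i @ \oo --> l i) ->
  (fun k => \sum_(i <- r) F i k) @ \oo --> \sum_(i <- r) l i.
Proof. by move=> Fl; apply: cvg_big => // ; exact: add_continuous. Qed.

Lemma is_derive_entry p q (W : R -> 'M[R]_(p, q)) (x : R) l i j :
  is_derive x 1 W l -> is_derive x 1 (fun s => W s i j) (l i j).
Proof.
move=> [dW Wl]; apply: DeriveDef; first by have /derivable_mxP/(_ i j) := dW.
by rewrite -Wl derive_mx // mxE.
Qed.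

Definition ecvg p q (u : nat -> 'M[R]_(p, q)) (l : 'M[R]_(p, q)) :=
  forall i j, (fun k => u k i j) @ \oo --> l i j.

Lemma ecvg_cst p q (l : 'M[R]_(p, q)) : ecvg (fun=> l) l.
Proof. by move=> i j; exact: cvg_cst. Qed.

Lemma ecvgD p q (u w : nat -> 'M[R]_(p, q)) l m :
  ecvg u l -> ecvg w m -> ecvg (fun k => u k + w k) (l + m).
Proof.
move=> ul wm i j; rewrite mxE.
under eq_fun do rewrite mxE.
exact: cvgD.
Qed.

Lemma ecvgM p q r (u : nat -> 'M[R]_(p, q)) (w : nat -> 'M[R]_(q, r)) l m :
  ecvg u l -> ecvg w m -> ecvg (fun k => u k *m w k) (l *m m).
Proof.
move=> ul wm i j; rewrite mxE.
under eq_fun do rewrite mxE.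
by apply: cvg_sumr => k; exact: cvgM.
Qed.

Lemma ecvg_linear n p q (L : {linear 'cV[R]_n -> 'M[R]_(p, q)}) u l :
  ecvg u l -> ecvg (fun k => L (u k)) (L l).
Proof.
have LE w : L w = \sum_b w b ord0 *: L (delta_mx b ord0).
  rewrite [w in LHS]matrix_sum_delta linear_sum; apply: eq_bigr => b _.
  by rewrite big_ord1 linearZ.
move=> ul i j; rewrite LE summxE.
under eq_fun do rewrite LE summxE.
apply: cvg_sumr => b; rewrite mxE.
under eq_fun do rewrite mxE.
exact: cvgMr_tmp.
Qed.

Lemma ecvg_unique p q (u : nat -> 'M[R]_(p, q)) l m :
  ecvg u l -> ecvg u m -> l = m.
Proof.
move=> ul um; apply/matrixP => i j.
exact: (cvg_unique _ (ul i j) (um i j)).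
Qed.

Lemma ecvg_within n (S : set (R * R)) (G : R -> R -> 'cV[R]_n) (s x : R)
    (sn xn : nat -> R) :
  {within S, continuous (fun p : R * R => G p.1 p.2)} ->
  S (s, x) -> (forall k, S (sn k, xn k)) -> sn @ \oo --> s -> xn @ \oo --> x ->
  ecvg (fun k => G (sn k) (xn k)) (G s x).
Proof.
move=> /subspace_continuousP Gc Ssx Sn sns xnx i j.
have pairc : (fun k => (sn k, xn k)) @ \oo --> within S (nbhs (s, x)).
  move=> P nP.
  have SP : \forall k \near \oo, S (sn k, xn k) -> P (sn k, xn k).
    exact: (cvg_pair sns xnx nP).
  by apply: filterS SP => k; apply; exact: Sn.
have := cvg_comp _ _ pairc (Gc _ Ssx) => /= GnG.
exact: (cvg_comp _ _ GnG (@coord_continuous R n 1 i j (G s x))).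
Qed.

End MatrixLimits.

Section ExactSolution.
Variables (R : realType) (n : nat) (A B C0 D : 'M[R]_n).
Variables (C1 : {linear 'cV[R]_n -> 'M[R]_n}) (te : R).
Variables (f : R -> R -> 'cV[R]_n) (phi : R -> 'cV[R]_n).
Variables (v : R -> R -> 'cV[R]_n) (dv : nat -> nat -> R -> R -> 'cV[R]_n).
Variable t : R.
Implicit Types (s x y : R) (c : 'I_n).
Let Q := [set p : R * R | (0 < p.1 <= te) && (0 <= p.2 <= 1)].
Let Qc := [set p : R * R | (0 <= p.1 <= te) && (0 <= p.2 <= 1)].
Hypothesis fc : {within Q, continuous (fun p : R * R => f p.1 p.2)}.
Hypothesis v_smooth : smooth_upto 4 te v dv.
Hypothesis v_solves : solves_ibvp A B C0 D C1 te f phi v dv.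
Hypothesis t_itv : 0 < t <= te.

(* Contractions of the closed rectangle towards its centre: they carry
   identities and inequalities from the open rectangle to the closed one. *)
Let cs k (s : R) := s + harmonic k * (t / 2 - s).
Let cx k (x : R) := x + harmonic k * (1 / 2 - x).

Let contract_cvg (c s : R) : (fun k => s + harmonic k * (c - s)) @ \oo --> s.
Proof.
have {3}-> : s = s + 0 * (c - s) by rewrite mul0r addr0.
by apply: cvgD; [exact: cvg_cst|apply: cvgMr_tmp; exact: cvg_harmonic].
Qed.

Let contract_in (T s : R) k : 0 < T -> 0 <= s <= T ->
  0 < s + harmonic k * (T / 2 - s) < T.
Proof.
move=> T0 /andP[s0 sT].
have h0 : 0 < harmonic k :> R by exact: harmonic_gt0.
have h1 : harmonic k <= 1 :> R by rewrite /= invf_le1 ?ler1n ?ltr0n.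
by apply/andP; split; nra.
Qed.

Let t_gt0 : 0 < t. Proof. by case/andP: t_itv. Qed.

Let cs_in k s : 0 <= s <= t -> 0 < cs k s < t.
Proof. exact: contract_in. Qed.

Let cs_te k s : 0 <= s <= t -> 0 < cs k s < te.
Proof.
move/(cs_in k)/andP => [-> /= /lt_le_trans ->] //.
by case/andP: t_itv.
Qed.

Let cx_in k x : 0 <= x <= 1 -> 0 < cx k x < 1.
Proof. exact: contract_in. Qed.

Let Q_in s x : 0 < s < te -> 0 < x < 1 -> Q (s, x).
Proof.
by move=> /andP[s0 /ltW st] /andP[/ltW x0 /ltW x1]; rewrite /Q /= s0 st x0 x1.
Qed.

Let Q_t s x : 0 < s <= t -> 0 <= x <= 1 -> Q (s, x).
Proof.
move=> /andP[s0 st] x01; rewrite /Q /= s0 x01 (le_trans st) //.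
by case/andP: t_itv.
Qed.

Let v_dv s x : Q (s, x) -> v s x = dv 0 0 s x.
Proof. by case: v_smooth => vE _ _ _ Qsx; rewrite (vE _ Qsx). Qed.

Let ecvg_dv a b s x : (a + b <= 4)%N -> 0 < s <= t -> 0 <= x <= 1 ->
  ecvg (fun k => dv a b (cs k s) (cx k x)) (dv a b s x).
Proof.
move=> ab st x01; case: v_smooth => _ dvc _ _.
apply: (@ecvg_within _ _ Q (dv a b)); [exact: dvc|exact: Q_t| |exact: contract_cvg..].
move=> k; apply: Q_in; last exact: cx_in.
by apply: cs_te; case/andP: st => /ltW -> ->.
Qed.

Let ecvg_v s x : 0 <= s <= t -> 0 <= x <= 1 ->
  ecvg (fun k => v (cs k s) (cx k x)) (v s x).
Proof.
move=> st x01; case: v_solves => _ _ _ vc.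
apply: (@ecvg_within _ _ Qc v); [exact: vc| | |exact: contract_cvg..].
  by case/andP: st => s0 st; rewrite /Qc /= s0 x01 (le_trans st) //; case/andP: t_itv.
move=> k; have /andP[/ltW s0 /ltW st'] := cs_te k st.
by have /andP[/ltW x0 /ltW x1] := cx_in k x01; rewrite /Qc /= s0 st' x0 x1.
Qed.

(** [solves_ibvp] gives the equation for s < te only, but the last time level t may equal te; the
    limit along the contractions closes this gap. *)
Lemma pde_closed s x : 0 < s <= t -> 0 <= x <= 1 ->
  A *m dv 1 0 s x + B *m dv 0 2 s x + Cof C0 C1 (v s x) *m dv 0 1 s x
  + D *m v s x = f s x.
Proof.
move=> st x01; have st0 : 0 <= s <= t by case/andP: st => /ltW -> ->.
apply: (@ecvg_unique _ _ _ (fun k => f (cs k s) (cx k x))); last first.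
  apply: (@ecvg_within _ _ Q f); [exact: fc|exact: Q_t| |exact: contract_cvg..].
  by move=> k; apply: Q_in; [exact: cs_te|exact: cx_in].
case: v_solves => pde _ _ _.
have -> : (fun k => f (cs k s) (cx k x)) = (fun k =>
    A *m dv 1 0 (cs k s) (cx k x) + B *m dv 0 2 (cs k s) (cx k x)
    + Cof C0 C1 (v (cs k s) (cx k x)) *m dv 0 1 (cs k s) (cx k x)
    + D *m v (cs k s) (cx k x)).
  by apply/funext => k; rewrite pde //; [exact: cs_te|exact: cx_in].
apply: ecvgD; last by apply: ecvgM; [exact: ecvg_cst|exact: ecvg_v].
apply: ecvgD; last first.
  apply: ecvgM; last exact: ecvg_dv.
  by apply: ecvgD; [exact: ecvg_cst|apply: ecvg_linear; exact: ecvg_v].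
by apply: ecvgD; apply: ecvgM; do ?[exact: ecvg_cst|exact: ecvg_dv].
Qed.

(** Only the time is contracted here; the boundary points stay fixed. *)
Lemma boundary_closed s : 0 < s <= t -> v s 0 = 0 /\ v s 1 = 0.
Proof.
move=> st; have st0 : 0 <= s <= t by case/andP: st => /ltW -> ->.
case: v_solves => _ bd _ vc.
have lim_x x : (x == 0) || (x == 1) ->
    ecvg (fun k => v (cs k s) x) (v s x).
  move=> x01.
  have xin : 0 <= x <= 1 by case/orP: x01 => /eqP ->; rewrite lexx ler01.
  apply: (@ecvg_within _ _ Qc v); [exact: vc| | |exact: contract_cvg|exact: cvg_cst].
    by case/andP: st0 => s0 st1; rewrite /Qc /= s0 xin (le_trans st1) //; case/andP: t_itv.
  by move=> k; have /andP[/ltW s0 /ltW st'] := cs_te k st0; rewrite /Qc /= s0 st' xin.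
split.
  apply: ecvg_unique (lim_x 0 _) _; first by rewrite eqxx.
  have -> : (fun k => v (cs k s) 0) = (fun=> 0).
    by apply/funext => k; case: (bd _ (cs_te k st0)).
  exact: ecvg_cst.
apply: ecvg_unique (lim_x 1 _) _; first by rewrite eqxx orbT.
have -> : (fun k => v (cs k s) 1) = (fun=> 0).
  by apply/funext => k; case: (bd _ (cs_te k st0)).
exact: ecvg_cst.
Qed.

Lemma dv_bounded : exists2 K : R, 0 <= K & forall a b, (a + b <= 4)%N ->
  forall (s x : R) c, 0 < s <= te -> 0 <= x <= 1 -> `|dv a b s x c ord0| <= K.
Proof.
case: v_smooth => _ _ bdd _.
have /choice[K KP] : forall ab : nat * nat, exists K : R,
    (ab.1 + ab.2 <= 4)%N -> forall p, Q p -> `|dv ab.1 ab.2 p.1 p.2| <= K.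
  move=> [a b] /=; have [le4|_] := boolP (a + b <= 4)%N; last by exists 0.
  by have [K KP] := bdd _ _ le4; exists K.
exists (\sum_(a < 5) \sum_(b < 5) `|K (val a, val b)|).
  by apply: sumr_ge0 => a _; apply: sumr_ge0 => b _.
move=> a b ab s x c st x01.
have a5 : (a < 5)%N by exact: leq_trans (leq_addr _ _) ab.
have b5 : (b < 5)%N by exact: leq_trans (leq_addl _ _) ab.
have Ks : `|K (a, b)| <= \sum_(a < 5) \sum_(b < 5) `|K (val a, val b)|.
  rewrite (bigD1 (Ordinal a5)) //= (bigD1 (Ordinal b5)) //= -addrA lerDl.
  rewrite addr_ge0 //; first by apply: sumr_ge0.
  by apply: sumr_ge0 => a' _; apply: sumr_ge0.
apply: le_trans Ks; apply: le_trans (ler_norm _).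
apply: le_trans (KP (a, b) ab (s, x) _); last by rewrite /Q /= st x01.
rewrite [leRHS]/Num.Def.normr /= mx_normrE.
exact: (le_bigmax _ _ (c, ord0)).
Qed.

Let deriv_t a b s x c : (a + b < 4)%N -> 0 < s < te -> 0 < x < 1 ->
  is_derive s 1 (fun s' => dv a b s' x c ord0) (dv a.+1 b s x c ord0).
Proof.
move=> ab st x01; case: v_smooth => _ _ _ /(_ _ _ ab _ _ st x01)[ds _].
exact: is_derive_entry ds.
Qed.

Let deriv_x a b s x c : (a + b < 4)%N -> 0 < s < te -> 0 < x < 1 ->
  is_derive x 1 (fun x' => dv a b s x' c ord0) (dv a b.+1 s x c ord0).
Proof.
move=> ab st x01; case: v_smooth => _ _ _ /(_ _ _ ab _ _ st x01)[_ dx].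
exact: is_derive_entry dx.
Qed.

Variable K : R.
Hypothesis K0 : 0 <= K.
Hypothesis dv_le : forall a b, (a + b <= 4)%N -> forall s x c,
  0 < s <= te -> 0 <= x <= 1 -> `|dv a b s x c ord0| <= K.

Let dv_le_in a b s x c : (a + b <= 4)%N -> 0 < s < te -> 0 < x < 1 ->
  `|dv a b s x c ord0| <= K.
Proof.
by move=> ab /andP[s0 /ltW st] /andP[/ltW x0 /ltW x1]; apply: dv_le; rewrite ?s0 ?x0.
Qed.

Lemma time_lipschitz s0 s1 x c : 0 <= s0 <= t -> 0 <= s1 <= t -> 0 <= x <= 1 ->
  `|v s1 x c ord0 - v s0 x c ord0| <= K * `|s1 - s0|.
Proof.
move=> s0t s1t x01.
have liml : (fun k => `|v (cs k s1) (cx k x) c ord0 - v (cs k s0) (cx k x) c ord0|) @ \oo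
    --> `|v s1 x c ord0 - v s0 x c ord0|.
  by apply: cvg_norm; apply: cvgB; exact: ecvg_v.
have limr : (fun k => K * `|cs k s1 - cs k s0|) @ \oo --> K * `|s1 - s0|.
  by apply: cvgMl_tmp; apply: cvg_norm; apply: cvgB; exact: contract_cvg.
apply: (ler_cvg_to liml limr); apply: nearW => k.
rewrite !v_dv; do ?by apply: Q_in; [exact: cs_te|exact: cx_in].
apply: (lipschitz_bound K0 (g := fun s => dv 0 0 s (cx k x) c ord0)
  (g1 := fun s => dv 1 0 s (cx k x) c ord0) _ (cs_te k s0t) (cs_te k s1t)) => s st.
  by apply: deriv_t => //; exact: cx_in.
by apply: dv_le_in => //; exact: cx_in.
Qed.

Lemma space_lipschitz s x0 x1 c : 0 <= s <= t -> 0 <= x0 <= 1 -> 0 <= x1 <= 1 ->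
  `|v s x1 c ord0 - v s x0 c ord0| <= K * `|x1 - x0|.
Proof.
move=> st x0t x1t.
have liml : (fun k => `|v (cs k s) (cx k x1) c ord0 - v (cs k s) (cx k x0) c ord0|) @ \oo
    --> `|v s x1 c ord0 - v s x0 c ord0|.
  by apply: cvg_norm; apply: cvgB; exact: ecvg_v.
have limr : (fun k => K * `|cx k x1 - cx k x0|) @ \oo --> K * `|x1 - x0|.
  by apply: cvgMl_tmp; apply: cvg_norm; apply: cvgB; exact: contract_cvg.
apply: (ler_cvg_to liml limr); apply: nearW => k.
rewrite !v_dv; do ?by apply: Q_in; [exact: cs_te|exact: cx_in].
apply: (lipschitz_bound K0 (g := fun x => dv 0 0 (cs k s) x c ord0)
  (g1 := fun x => dv 0 1 (cs k s) x c ord0) _ (cx_in k x0t) (cx_in k x1t)) => x x01.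
  by apply: deriv_x => //; exact: cs_te.
by apply: dv_le_in => //; exact: cs_te.
Qed.

(** The centre s1, later the new time level, is positive because v_t is not controlled at time 0; s0
    = 0 occurs in the first step. *)
Lemma time_taylor s0 s1 x c : 0 <= s0 <= t -> 0 < s1 <= t -> 0 <= x <= 1 ->
  `|v s0 x c ord0 - v s1 x c ord0 - (s0 - s1) * dv 1 0 s1 x c ord0|
    <= K * `|s0 - s1| ^+ 2.
Proof.
move=> s0t s1t x01; have s1t' : 0 <= s1 <= t by case/andP: s1t => /ltW -> ->.
have liml : (fun k => `|v (cs k s0) (cx k x) c ord0 - v (cs k s1) (cx k x) c ord0
      - (cs k s0 - cs k s1) * dv 1 0 (cs k s1) (cx k x) c ord0|) @ \oo
    --> `|v s0 x c ord0 - v s1 x c ord0 - (s0 - s1) * dv 1 0 s1 x c ord0|.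
  apply: cvg_norm; apply: cvgB; first by apply: cvgB; exact: ecvg_v.
  by apply: cvgM; [apply: cvgB; exact: contract_cvg|exact: ecvg_dv].
have limr : (fun k => K * `|cs k s0 - cs k s1| ^+ 2) @ \oo --> K * `|s0 - s1| ^+ 2.
  apply: cvgMl_tmp; rewrite expr2; under eq_fun do rewrite expr2.
  by apply: cvgM; apply: cvg_norm; apply: cvgB; exact: contract_cvg.
apply: (ler_cvg_to liml limr); apply: nearW => k.
rewrite !v_dv; do ?by apply: Q_in; [exact: cs_te|exact: cx_in].
apply: (taylor2_bound K0 (g := fun s => dv 0 0 s (cx k x) c ord0)
  (g1 := fun s => dv 1 0 s (cx k x) c ord0) (g2 := fun s => dv 2 0 s (cx k x) c ord0)
  _ _ (cs_te k s1t') (cs_te k s0t)) => s st.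
- by apply: deriv_t => //; exact: cx_in.
- by apply: deriv_t => //; exact: cx_in.
by apply: dv_le_in => //; exact: cx_in.
Qed.

Lemma space_taylor s x0 x1 c : 0 < s <= t -> 0 <= x0 <= 1 -> 0 <= x1 <= 1 ->
  `|v s x1 c ord0 - v s x0 c ord0 - (x1 - x0) * dv 0 1 s x0 c ord0|
    <= K * `|x1 - x0| ^+ 2.
Proof.
move=> st x0t x1t; have st' : 0 <= s <= t by case/andP: st => /ltW -> ->.
have liml : (fun k => `|v (cs k s) (cx k x1) c ord0 - v (cs k s) (cx k x0) c ord0
      - (cx k x1 - cx k x0) * dv 0 1 (cs k s) (cx k x0) c ord0|) @ \oo
    --> `|v s x1 c ord0 - v s x0 c ord0 - (x1 - x0) * dv 0 1 s x0 c ord0|.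
  apply: cvg_norm; apply: cvgB; first by apply: cvgB; exact: ecvg_v.
  by apply: cvgM; [apply: cvgB; exact: contract_cvg|exact: ecvg_dv].
have limr : (fun k => K * `|cx k x1 - cx k x0| ^+ 2) @ \oo --> K * `|x1 - x0| ^+ 2.
  apply: cvgMl_tmp; rewrite expr2; under eq_fun do rewrite expr2.
  by apply: cvgM; apply: cvg_norm; apply: cvgB; exact: contract_cvg.
apply: (ler_cvg_to liml limr); apply: nearW => k.
rewrite !v_dv; do ?by apply: Q_in; [exact: cs_te|exact: cx_in].
apply: (taylor2_bound K0 (g := fun x => dv 0 0 (cs k s) x c ord0)
  (g1 := fun x => dv 0 1 (cs k s) x c ord0) (g2 := fun x => dv 0 2 (cs k s) x c ord0)
  _ _ (cx_in k x0t) (cx_in k x1t)) => x x01.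
- by apply: deriv_x => //; exact: cs_te.
- by apply: deriv_x => //; exact: cs_te.
by apply: dv_le_in => //; exact: cs_te.
Qed.

Lemma space_central s x y c : 0 < s <= t -> 0 <= x - y -> 0 <= y -> x + y <= 1 ->
  `|v s (x - y) c ord0 - 2 * v s x c ord0 + v s (x + y) c ord0
     - y ^+ 2 * dv 0 2 s x c ord0| <= 2 * K * `|y| ^+ 4.
Proof.
move=> st xy0 y0 xy1; have st' : 0 <= s <= t by case/andP: st => /ltW -> ->.
have x_in : 0 <= x <= 1 by lra.
have m_in : 0 <= x - y <= 1 by lra.
have p_in : 0 <= x + y <= 1 by lra.
(* The contraction is affine, so it maps x - y, x, x + y to an equidistant triple in the open
   interval, with spacing [yk k]. *)
pose yk k := (1 - harmonic k) * y.
have yk_cvg : yk @ \oo --> y.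
  rewrite -[X in _ --> X]mul1r -[X in X * y]subr0.
  by apply: cvgMr_tmp; apply: cvgB; [exact: cvg_cst|exact: cvg_harmonic].
have cxB k : cx k (x - y) = cx k x - yk k by rewrite /cx /yk; ring.
have cxD k : cx k (x + y) = cx k x + yk k by rewrite /cx /yk; ring.
have liml : (fun k => `|v (cs k s) (cx k (x - y)) c ord0 - 2 * v (cs k s) (cx k x) c ord0
      + v (cs k s) (cx k (x + y)) c ord0 - yk k ^+ 2 * dv 0 2 (cs k s) (cx k x) c ord0|) @ \oo
    --> `|v s (x - y) c ord0 - 2 * v s x c ord0 + v s (x + y) c ord0
     - y ^+ 2 * dv 0 2 s x c ord0|.
  apply: cvg_norm; apply: cvgB.
    apply: cvgD; last exact: ecvg_v.
    by apply: cvgB; [exact: ecvg_v|apply: cvgMl_tmp; exact: ecvg_v].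
  apply: cvgM; last exact: ecvg_dv.
  by rewrite expr2; under eq_fun do rewrite expr2; apply: cvgM; exact: yk_cvg.
have limr : (fun k => 2 * K * `|yk k| ^+ 4) @ \oo --> 2 * K * `|y| ^+ 4.
  apply: cvgMl_tmp; rewrite (_ : 4 = 2 + 2)%N // exprD.
  under eq_fun do rewrite exprD !expr2.
  by do ![apply: cvgM]; apply: cvg_norm; exact: yk_cvg.
apply: (ler_cvg_to liml limr); apply: nearW => k.
rewrite !v_dv; do ?by apply: Q_in; [exact: cs_te|exact: cx_in].
rewrite cxB cxD.
apply: (central_diff_bound K0 (a := 0) (b := 1)
  (g := fun x => dv 0 0 (cs k s) x c ord0)
  (g1 := fun x => dv 0 1 (cs k s) x c ord0) (g2 := fun x => dv 0 2 (cs k s) x c ord0)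
  (g3 := fun x => dv 0 3 (cs k s) x c ord0) (g4 := fun x => dv 0 4 (cs k s) x c ord0)).
1-4: by move=> z z01; apply: deriv_x => //; exact: cs_te.
- exact: cx_in.
- by rewrite -cxB; exact: cx_in.
- by rewrite -cxD; exact: cx_in.
by move=> z z01; apply: dv_le_in => //; exact: cs_te.
Qed.

(** For comparing v_t at a grid node with b_r. The path has one leg in each variable, so [K] has to
    bound v_tt and v_tx. *)
Lemma dv10_lipschitz s0 s1 x0 x1 c :
  0 < s0 < te -> 0 < s1 < te -> 0 < x0 < 1 -> 0 < x1 < 1 ->
  `|dv 1 0 s1 x1 c ord0 - dv 1 0 s0 x0 c ord0| <= K * (`|s1 - s0| + `|x1 - x0|).
Proof.
move=> s0t s1t x0t x1t.
have -> : dv 1 0 s1 x1 c ord0 - dv 1 0 s0 x0 c ord0 =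
  (dv 1 0 s1 x1 c ord0 - dv 1 0 s0 x1 c ord0) +
  (dv 1 0 s0 x1 c ord0 - dv 1 0 s0 x0 c ord0) by ring.
apply: le_trans (ler_normD _ _) _; rewrite mulrDr lerD //.
  apply: (lipschitz_bound K0 (g := fun s => dv 1 0 s x1 c ord0)
    (g1 := fun s => dv 2 0 s x1 c ord0) _ s0t s1t) => s st.
    exact: deriv_t.
  exact: dv_le_in.
apply: (lipschitz_bound K0 (g := fun x => dv 1 0 s0 x c ord0)
  (g1 := fun x => dv 1 1 s0 x c ord0) _ x0t x1t) => x x01.
  exact: deriv_x.
exact: dv_le_in.
Qed.

(** The columns of [cokermx W] are functionals vanishing on the row space of [W]. Applied to v they
    have time derivative 0, hence are constant in time by [lipschitz_bound] with constant 0; no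
    integral of v_t is formed. *)
Lemma increment_in_span d (W : 'M[R]_(d, n)) s0 s1 x :
  (forall s y, 0 < s < t -> 0 < y < 1 -> ((dv 1 0 s y)^T <= W)%MS) ->
  0 <= s0 <= t -> 0 <= s1 <= t -> 0 <= x <= 1 ->
  ((v s1 x - v s0 x)^T <= W)%MS.
Proof.
move=> spanW s0t s1t x01; rewrite submxE; apply/eqP.
have : forall s y, 0 < s < t -> 0 < y < 1 -> (dv 1 0 s y)^T *m cokermx W = 0.
  by move=> s y st y01; apply/eqP; rewrite -submxE spanW.
move: (cokermx W) => Z {}spanW.
have vanish k : (v (cs k s1) (cx k x) - v (cs k s0) (cx k x))^T *m Z = 0.
  set y := cx k x; have y01 : 0 < y < 1 by exact: cx_in.
  apply/matrixP => i c; rewrite mxE [RHS]mxE ord1.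
  pose g (s : R) := \sum_b (Z b c *: (fun s => dv 0 0 s y b ord0 : R)) s.
  have dg s : 0 < s < t -> is_derive s 1 g 0.
    move=> st; have ste : 0 < s < te.
      by case/andP: st => -> /lt_le_trans ->//; case/andP: t_itv.
    have -> : g = \sum_b (Z b c *: (fun s => dv 0 0 s y b ord0 : R)).
      by apply/funext => w; rewrite fct_sumE.
    have -> : 0 = \sum_b (Z b c * dv 1 0 s y b ord0 : R).
      have /matrixP/(_ ord0 c) := spanW _ _ st y01; rewrite !mxE => dvZ; rewrite -[LHS]dvZ.
      by apply: eq_bigr => b _; rewrite mxE mulrC.
    by apply: is_derive_sum => b; apply: is_deriveZ; exact: deriv_t.
  have norm0 s : 0 < s < t -> `|0 : R| <= 0 by rewrite normr0.
  have := lipschitz_bound (lexx 0) dg (cs_in k s0t) (cs_in k s1t) norm0.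
  rewrite mul0r normr_le0 subr_eq0 => /eqP gE.
  transitivity (g (cs k s1) - g (cs k s0)); last by rewrite gE subrr.
  rewrite /g -sumrB; apply: eq_bigr => b _.
  rewrite !mxE !v_dv; do ?by apply: Q_in; [exact: cs_te|exact: cx_in].
  by rewrite mulrBl ![_ * Z b c]mulrC.
apply: (@ecvg_unique _ _ _ (fun k =>
  (v (cs k s1) (cx k x) - v (cs k s0) (cx k x))^T *m Z)); last first.
  by move=> i c; under eq_fun do rewrite vanish; exact: cvg_cst.
apply: ecvgM; last exact: ecvg_cst.
move=> i c; rewrite !mxE; under eq_fun do rewrite !mxE.
by apply: cvgB; exact: ecvg_v.
Qed.

End ExactSolution.

(** * Comparison of the blocks with E_4 *)

Section SpanningFamily.
Variable R : realType.

(** Among finite families of points one of maximal rank is taken; a value outside its span would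
    raise the rank. The spanning vectors are values at actual points, so that grid nodes can be
    found near these. *)
Lemma spanning_family (T : Type) n (P : T -> Prop) (w : T -> 'rV[R]_n) :
  exists d (pt : 'I_d -> T), (forall r, P (pt r)) /\
    forall p, P p -> (w p <= \matrix_(r < d) w (pt r))%MS.
Proof.
pose attained (k : nat) := `[< exists d (pt : 'I_d -> T), (forall r, P (pt r)) /\
  \rank (\matrix_(r < d) w (pt r)) = k >].
have ex0 : exists k, attained k.
  have pt0 : 'I_0 -> T by case.
  exists (\rank (\matrix_(r < 0) w (pt0 r))); apply/asboolP.
  by exists 0%N, pt0; split=> // -[].
have le_n k : attained k -> (k <= n)%N.
  by move/asboolP => [d [pt [_ <-]]]; exact: rank_leq_col.
case: (ex_maxnP ex0 le_n) => k /asboolP[d [pt [Ppt rk]]] kmax.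
exists d, pt; split=> // p Pp; apply: contraT => notin.
pose pt' (i : 'I_(1 + d)) := match fintype.split i with inl _ => p | inr r => pt r end.
have ptE : \matrix_(i < 1 + d) w (pt' i) = col_mx (w p) (\matrix_(r < d) w (pt r)).
  apply/matrixP => i c; rewrite !mxE /pt'; case: (fintype.split i) => r; rewrite ?mxE //.
  by rewrite ord1.
have : attained (\rank (col_mx (w p) (\matrix_(r < d) w (pt r)))).
  apply/asboolP; exists (1 + d)%N, pt'; rewrite ptE; split=> // i.
  by rewrite /pt'; case: (fintype.split i).
move/kmax; rewrite -rk leqNgt => /negP[].
apply: rank_ltmx; rewrite /ltmx -!addsmxE addsmxSr /=.
by apply: contra notin; apply: submx_trans; exact: addsmxSl.
Qed.

End SpanningFamily.

Section Bigmax.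
Variable R : realType.

Lemma le_bigmax_nat_at (F : nat -> R) a b k : (a <= k < b)%N ->
  F k <= \big[Num.max/0]_(a <= l < b) F l.
Proof. by move=> kab; apply: le_bigmax_seq => //; rewrite mem_index_iota. Qed.

Lemma bigmax_nat_ge0 (F : nat -> R) a b : 0 <= \big[Num.max/0]_(a <= l < b) F l.
Proof. by elim/big_rec: _ => // l x _ x0; rewrite le_max x0 orbT. Qed.

End Bigmax.

Section Comparison.
Variables (R : realType) (n N : nat) (A B C0 D : 'M[R]_n) (tau : R).
Local Notation G0 := (G0mx A B C0 D tau N.+1 : 'M[R]_(N * n)).
Local Notation Gk k := (G0k A B C0 D tau N.+1 k).
Hypothesis Gk_unit : forall k, (1 <= k < N.+1)%N -> Gk k \in unitmx.

(** Of the sum in [invG0_bdiag_lower] only the nodes a, ..., a + 2p - 1 are kept. By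
    [sum_sin2_interval], multiplied by 2 / (N + 1), their weights add up to at least 1 / (Q 11^Q),
    uniformly in k. *)
Lemma invG0_bdiag_interval (X : 'I_N -> 'M[R]_n) (k : 'I_N) y mu a p Q :
  0 <= mu -> (0 < a)%N -> (a + p + p <= N.+1)%N -> (N.+1 <= Q * p)%N ->
  (forall i : 'I_N, (a <= i.+1 < a + p + p)%N ->
     mu <= hnorm 1 ((X i)^T *m ((invmx (Gk k.+1))^T *m y))) ->
  mu ^+ 2 <= Q%:R * 11 ^+ Q * (opnorm 1 (invmx G0 *m bdiag X) ^+ 2 * sqn y).
Proof.
move=> mu0 a0 apN NQ Xmu.
have M0 : 0 < N.+1%:R :> R by rewrite ltr0n.
have Q0 : 0 <= Q%:R * 11 ^+ Q :> R by rewrite mulr_ge0 ?exprn_ge0.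
apply: le_trans (ler_wpM2l Q0 (invG0_bdiag_lower Gk_unit X k y)).
pose g (l : nat) := sin (l%:R * (k.+1%:R * pi / N.+1%:R)) ^+ 2 : R.
have kN : (0 < k.+1 < N.+1)%N by exact: ltn_ord k.
have mass := @sum_sin2_interval R _ _ a _ _ kN NQ.
rewrite -/g in mass.
(* Grid node l is the ordinal l - 1; a > 0 excludes the boundary node 0. *)
have sum_ord : \sum_(a <= l < a + p + p) g l =
    \sum_(i < N | (a <= i.+1 < a + p + p)%N) g i.+1.
  rewrite -(prednK a0) !addSn big_add1 /= (big_nat_widen _ _ N); last by lia.
  rewrite (big_nat_widenl _ 0%N) // big_mkord.
  by apply: eq_bigl => i /=; rewrite !ltnS andbC.
apply: (@le_trans _ _ (Q%:R * 11 ^+ Q *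
    (2 / N.+1%:R * (\sum_(a <= l < a + p + p) g l) * mu ^+ 2))).
  have u0 : 0 <= 2 / N.+1%:R * mu ^+ 2 by rewrite mulr_ge0 ?sqr_ge0 ?divr_ge0.
  have := ler_wpM2l u0 mass; congr (_ <= _); last by ring.
  by field; rewrite gt_eqF.
rewrite ler_wpM2l // sum_ord mulr_sumr mulr_suml.
rewrite [leRHS](bigID (fun i : 'I_N => (a <= i.+1 < a + p + p)%N)) /= -[leLHS]addr0.
rewrite lerD //; last by apply: sumr_ge0 => i _; rewrite mulr_ge0 ?sqr_ge0 ?sqn_ge0.
apply: ler_sum => i ai; rewrite /g mxE exprMn sqr_sqrtr; last by rewrite divr_ge0.
apply: ler_wpM2l; first by rewrite mulr_ge0 ?sqr_ge0 ?divr_ge0.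
rewrite -hnorm1_sqr.
by rewrite ler_sqr ?nnegrE ?hnorm_ge0 //; exact: Xmu.
Qed.

End Comparison.

Section GridComparison.
Variables (R : realType) (n N : nat) (A B C0 D : 'M[R]_n) (tau : R).
Variable C1 : {linear 'cV[R]_n -> 'M[R]_n}.
Local Notation G0 := (G0mx A B C0 D tau N.+1 : 'M[R]_(N * n)).
Local Notation Gk k := (G0k A B C0 D tau N.+1 k).
Hypothesis Gk_unit : forall k, (1 <= k < N.+1)%N -> Gk k \in unitmx.
Variables (d m : nat) (b : 'I_d -> 'cV[R]_n) (w : nat -> nat -> 'cV[R]_n).

(* Test on S_k (x) y: with z = G0k^-T y and q maximizing |C1(b_q)^T z|, the
   blocks of E_4^j near the space-time point of b_q keep half of that maximum,
   and S_k has a fixed share of its mass on the corresponding grid interval. *)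
Lemma invG0k_le_invG0_E4 Z p Q : (N.+1 <= Q * p)%N -> 0 <= Z ->
  (forall j, (1 <= j < m.+2)%N ->
     opnorm 1 (invmx G0 *m (E4mx C1 (stack N.+1 (w j)) : 'M[R]_(N * n))) <= Z) ->
  (forall r, exists j a, [/\ (1 <= j < m.+2)%N, (0 < a)%N, (a + p + p <= N.+1)%N &
     forall l, (a <= l < a + p + p)%N -> exists al : 'I_d -> R,
       w j l = b r + \sum_q al q *: b q /\ \sum_q `|al q| <= 2^-1]) ->
  forall k r, (1 <= k < N.+1)%N ->
    opnorm 1 (invmx (Gk k) *m C1 (b r)) <= 2 * Num.sqrt (Q%:R * 11 ^+ Q) * Z.
Proof.
move=> NQ Z0 E4Z near [//|k] r kN.
have Q0 : 0 <= Q%:R * 11 ^+ Q :> R by rewrite mulr_ge0 ?exprn_ge0.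
apply: opnorm_tr_le => [|y]; first by rewrite !mulr_ge0 ?sqrtr_ge0.
rewrite trmx_mul -mulmxA; set z := (invmx _)^T *m y.
pose mu q := hnorm 1 ((C1 (b q))^T *m z).
(* [q] may vary with the frequency and with [y], and so may the grid interval used; the constants do
   not. *)
case: (@arg_maxP _ R _ r predT mu isT) => q _ qmax0.
have qmax q' : mu q' <= mu q by exact: qmax0.
apply: le_trans (qmax r) _.
have [j [a [jm a0 apN nearq]]] := near q.
have kN' : (k < N)%N by rewrite -ltnS.
pose X (i : 'I_N) : 'M[R]_n := C1 (w j i.+1).
have E4X : (E4mx C1 (stack N.+1 (w j)) : 'M[R]_(N * n)) = bdiag X.
  rewrite /E4mx btens1E; congr bdiag; apply/funext => i.
  by rewrite /X blk_stack.
have mu2 : 0 <= mu q / 2 by rewrite divr_ge0 ?hnorm_ge0.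
have := invG0_bdiag_interval Gk_unit (k := Ordinal kN') (y := y) mu2 a0 apN NQ.
move=> /(_ X) lower.
have Xmu (i : 'I_N) : (a <= i.+1 < a + p + p)%N -> mu q / 2 <= hnorm 1 ((X i)^T *m z).
  move=> /nearq[al [wE al2]]; rewrite /X wE linearD linear_sum /=.
  rewrite linearD /= mulmxDl.
  set e := (\sum_i0 _)^T *m z.
  have e_le : hnorm 1 e <= 2^-1 * mu q.
    rewrite /e raddf_sum /= mulmx_suml.
    apply: le_trans (hnorm_sum _ _ _ ler01) _.
    apply: le_trans (ler_wpM2r (hnorm_ge0 _ _) al2); rewrite mulr_suml.
    apply: ler_sum => q' _; rewrite linearZ /= linearZ /= -scalemxAl hnormZ //.
    by rewrite ler_wpM2l // qmax.
  have : mu q <= hnorm 1 ((C1 (b q))^T *m z + e) + hnorm 1 e.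
    by have := hnorm1D ((C1 (b q))^T *m z + e) (- e); rewrite addrK hnormN.
  by lra.
have := lower Xmu.
rewrite -E4X -hnorm1_sqr -exprMn => le_sq.
rewrite -ler_sqr ?nnegrE ?mulr_ge0 ?sqrtr_ge0 ?hnorm_ge0 //.
have -> : (2 * Num.sqrt (Q%:R * 11 ^+ Q) * Z * hnorm 1 y) ^+ 2
    = 4 * (Q%:R * 11 ^+ Q * (Z * hnorm 1 y) ^+ 2).
  by rewrite !exprMn sqr_sqrtr // -natrX; ring.
have -> : mu q ^+ 2 = 4 * (mu q / 2) ^+ 2 by field.
rewrite ler_pM2l //; apply: le_trans le_sq _; rewrite ler_wpM2l //.
rewrite ler_sqr ?nnegrE ?mulr_ge0 ?opnorm_ge0 ?hnorm_ge0 //.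
by rewrite ler_wpM2r ?hnorm_ge0 // E4Z.
Qed.

(* Bound for the part of the truncation error that comes from freezing the
   coefficient C at the old time level. *)
Lemma hnorm_invG0_C1 (c al : R) (w0 : 'I_N -> 'cV[R]_n) (e : 'cV[R]_(N * n)) :
  0 <= c -> 0 <= al ->
  (forall k r, (1 <= k < N.+1)%N -> opnorm 1 (invmx (Gk k) *m C1 (b r)) <= c) ->
  (forall i, exists a : 'I_d -> R, w0 i = \sum_q a q *: b q /\
     forall q, `|a q| <= al) ->
  hnorm 1 (invmx G0 *m (bdiag (fun i => C1 (w0 i)) *m e))
    <= d%:R * (c * al) * hnorm 1 e.
Proof.
move=> c0 al0 Cc /choice[a aP].
(* The coordinates of [w0 i] depend on the node, the matrices C1(b_q) do not. The constant factor,
   next to G_0^-1, is treated by [opnorm_invG0_tens], the scalar one by [opnorm_bdiag_le]. *)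
have -> : bdiag (fun i => C1 (w0 i)) =
    \sum_q (1%:M *t C1 (b q)) *m bdiag (fun i => (a i q)%:M).
  apply: mulmx_ext => x; apply: blk_inj => i.
  rewrite mulmx_suml blk_bdiag (aP i).1 linear_sum mulmx_suml.
  have -> (F : 'I_d -> 'cV[R]_(N * n)) : blk (\sum_q F q) i = \sum_q blk (F q) i.
    by apply/matrixP => l j; rewrite !mxE !summxE; apply: eq_bigr => q _; rewrite mxE.
  apply: eq_bigr => q _; rewrite linearZ /= -mulmxA tens1E !blk_bdiag.
  by rewrite mul_scalar_mx -scalemxAl -scalemxAr.
rewrite mulmx_suml mulmx_sumr; apply: le_trans (hnorm_sum _ _ _ ler01) _.
have -> : d%:R * (c * al) * hnorm 1 e = \sum_(q < d) c * al * hnorm 1 e.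
  by rewrite sumr_const card_ord -[RHS]mulr_natl !mulrA.
apply: ler_sum => q _; rewrite -[_ *m _ *m e]mulmxA [invmx _ *m _]mulmxA.
apply: le_trans (hnorm_mulmx_le _ _ ltr01) _; rewrite -mulrA.
apply: ler_pM; rewrite ?opnorm_ge0 ?hnorm_ge0 //.
  exact: (opnorm_invG0_tens Gk_unit c0 (fun k kN => Cc k q kN)).
apply: le_trans (hnorm_mulmx_le _ _ ltr01) _; rewrite ler_wpM2r ?hnorm_ge0 //.
apply: opnorm_bdiag_le => // i; apply: opnorm_le => // x.
by rewrite mul_scalar_mx hnormZ // ler_wpM2r ?hnorm_ge0 //; exact: (aP i).2.
Qed.

End GridComparison.

Section SpanCoordinates.
Variables (R : realType) (n d : nat) (b : 'I_d -> 'cV[R]_n).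
Let W : 'M[R]_(d, n) := \matrix_r (b r)^T.

(** With the fixed matrix [pinvmx W] the coordinates are linear in [w], and [P] is its sum of
    absolute entries; the b_q may be linearly dependent. *)
Lemma span_coordinates : exists2 P : R, 0 <= P &
  forall (w : 'cV[R]_n) (K : R), (w^T <= W)%MS -> (forall c, `|w c ord0| <= K) ->
  exists a : 'I_d -> R, [/\ w = \sum_q a q *: b q, forall q, `|a q| <= P * K
    & \sum_q `|a q| <= P * K].
Proof.
exists (\sum_q \sum_c `|pinvmx W c q|).
  by apply: sumr_ge0 => q _; apply: sumr_ge0.
move=> w K wW wK; pose a (q : 'I_d) : R := (w^T *m pinvmx W) ord0 q.
have sum_le : \sum_q `|a q| <= (\sum_q \sum_c `|pinvmx W c q|) * K.
  rewrite mulr_suml; apply: ler_sum => q _; rewrite /a mxE.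
  apply: le_trans (ler_norm_sum _ _ _) _; rewrite mulr_suml.
  by apply: ler_sum => c _; rewrite normrM mulrC [w^T _ _]mxE ler_wpM2l.
exists a; split=> //.
  apply/matrixP => c j; rewrite ord1 summxE.
  have /matrixP/(_ ord0 c) := mulmxKpV wW; rewrite mxE [w^T _ _]mxE => <-.
  have WE q : W q c = b q c ord0 by rewrite !mxE.
  by apply: eq_bigr => q _; rewrite WE [RHS]mxE.
move=> q; apply: le_trans sum_le; rewrite (bigD1 q) //= lerDl.
by apply: sumr_ge0.
Qed.

End SpanCoordinates.

Section GridPoints.
Variable R : realType.
Implicit Types rho tau t s x : R.

Lemma time_near rho tau t s m : 0 < tau < rho -> m.+1%:R * tau = t ->
  rho <= s -> rho <= t - s ->
  exists j, [/\ (1 <= j < m.+2)%N, `|j%:R * tau - s| < rho & j%:R * tau < t].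
Proof.
move=> /andP[tau0 taurho] mt rs rts.
have s0 : 0 <= s / tau by rewrite divr_ge0 ?ltW //; lra.
have /andP[] := truncn_itv s0; set q := Num.truncn _ => qs sq.
have qs' : q%:R * tau <= s by rewrite -ler_pdivlMr.
have sq' : s < q.+1%:R * tau by rewrite -ltr_pdivrMr.
have qE : q.+1%:R * tau = q%:R * tau + tau by rewrite -natr1; ring.
(* The first grid time after s overshoots by at most tau < rho and stays below t because rho <= t -
   s. *)
exists q.+1; have lt_t : q.+1%:R * tau < t by lra.
split=> //; last by rewrite gtr0_norm ?subr_gt0 //; lra.
have qm : (q.+1 < m.+1)%N by rewrite -(ltr_nat R) -(ltr_pM2r tau0) mt.
by rewrite ltn0Sn ltnW.
Qed.

(** A stretch of length rho has rho M mesh cells, room for 2p consecutive nodes. The condition 4 <=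
    rho M ensures p >= rho M / 4 despite the truncation, so the number of blocks covering the grid
    depends on rho only. *)
Lemma space_near rho x M : 0 < rho -> 4 <= rho * M%:R ->
  rho <= x -> rho <= 1 - x ->
  let p := Num.truncn (rho * M%:R / 2) in
  (M <= (Num.truncn (4 / rho)).+1 * p)%N /\
  exists a, [/\ (0 < a)%N, (a + p + p <= M)%N &
    forall l, (a <= l < a + p + p)%N -> `|l%:R * mesh R M - x| <= rho].
Proof.
move=> rho0 rhoM rx r1x p.
have M0 : 0 < M%:R :> R by rewrite -(pmulr_rgt0 _ rho0) (lt_le_trans _ rhoM).
have /andP[p_le p_gt] : p%:R <= rho * M%:R / 2 < p.+1%:R.
  by apply: truncn_itv; rewrite divr_ge0 // (le_trans _ rhoM).
clearbody p.
have /andP[_ Q_gt] : (Num.truncn (4 / rho))%:R <= 4 / rho < (Num.truncn (4 / rho)).+1%:R.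
  by apply: truncn_itv; rewrite divr_ge0 ?ltW.
set Q := (Num.truncn (4 / rho)).+1 in Q_gt *.
split.
  rewrite -(ler_nat R) natrM.
  have Qr : 4 < Q%:R * rho by rewrite -ltr_pdivrMr.
  have p4 : rho * M%:R / 4 <= p%:R by move: p_gt; rewrite -[p.+1%:R]natr1; lra.
  apply: le_trans (ler_wpM2l (ler0n _ Q) p4).
  have -> : Q%:R * (rho * M%:R / 4) = (Q%:R * rho) * (M%:R / 4) by ring.
  have : 4 * (M%:R / 4) <= (Q%:R * rho) * (M%:R / 4).
    by rewrite ler_wpM2r ?ltW // divr_gt0.
  by apply: le_trans; lra.
have /andP[a_le a_gt] : (Num.truncn ((x - rho) * M%:R))%:R <= (x - rho) * M%:R
    < (Num.truncn ((x - rho) * M%:R)).+1%:R.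
  by apply: truncn_itv; rewrite mulr_ge0 ?subr_ge0.
set a := Num.truncn ((x - rho) * M%:R) in a_le a_gt.
exists a.+1; split=> //.
  rewrite !addSn -(ltr_nat R) !natrD.
  have : (x - rho) * M%:R + rho * M%:R <= (1 - rho) * M%:R.
    by rewrite -mulrDl ler_wpM2r //; lra.
  have -> : (1 - rho) * M%:R = M%:R - rho * M%:R by ring.
  by lra.
move=> l /andP[al lap].
have lM : l%:R * mesh R M * M%:R = l%:R by rewrite /mesh -mulrA mulVf ?mulr1 ?gt_eqF.
have la : (x - rho) * M%:R <= l%:R by apply: le_trans (ltW a_gt) _; rewrite ler_nat.
have lx : l%:R <= (x + rho) * M%:R.
  have : l%:R <= a%:R + p%:R + p%:R :> R by rewrite -!natrD ler_nat -ltnS -!addSn.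
  by rewrite mulrBl in a_le; rewrite mulrDl; lra.
rewrite ler_norml; apply/andP; split.
  by rewrite -(ler_pM2r M0) [leRHS]mulrBl lM; rewrite mulrBl in la; lra.
by rewrite -(ler_pM2r M0) [leLHS]mulrBl lM; rewrite mulrDl in lx; lra.
Qed.

End GridPoints.

(** * Truncation error and error recursion *)

Section ErrorRecursion.
Variables (R : realType) (n : nat) (A B C0 D : 'M[R]_n).
Variable C1 : {linear 'cV[R]_n -> 'M[R]_n}.
Variables (tau : R) (M : nat) (U V : nat -> 'cV[R]_(M.-1 * n)).
Let h := mesh R M.
Let eta j := V j - U j.

(** Defined as the defect in the error recursion, which then holds by definition; [truncationE]
    connects it with the differential equation. *)
Definition truncation j : 'cV[R]_(M.-1 * n) :=
  Gmx A B C0 D C1 tau (U j) *m eta j.+1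
  - (1%:M *t (tau^-1 *: A) - h^-1 *: Ctil C1 (V j.+1)) *m eta j.

(** The Duhamel sum has m + 1 terms of size Kp R0 / (1 - delta); since (m + 1) tau = t, this count
    is the factor t / tau of the theorem. *)
Lemma error_bound m (Kp R0 delta : R) : (0 < M)%N -> eta 0%N = 0 -> 0 <= Kp ->
  G0mx A B C0 D tau M \in unitmx -> delta < 1 ->
  (forall j, (j <= m)%N ->
     opnorm h (invmx (G0mx A B C0 D tau M)) * opnorm h (G1mx C0 C1 (U j)) <= delta) ->
  (forall j, (1 <= j <= m.+1)%N ->
     opnorm h (\big[mulmx/1%:M]_(l <- rev (index_iota j m.+1))
       Hmx A B C0 D C1 tau (U l) (V l.+1)) <= Kp) ->
  (forall j, (j <= m)%N ->
     hnorm h (invmx (G0mx A B C0 D tau M) *m truncation j) <= R0) ->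
  hnorm h (eta m.+1) <= Kp / (1 - delta) * m.+1%:R * R0.
Proof.
move=> M0 eta0 Kp0 G0u d1 small prodK truncR.
have h0 : 0 < h by rewrite invr_gt0 ltr0n.
pose H l := Hmx A B C0 D C1 tau (U l) (V l.+1).
pose r j := invmx (Gmx A B C0 D C1 tau (U j)) *m truncation j.
have Gu j : (j <= m)%N -> Gmx A B C0 D C1 tau (U j) \in unitmx.
  by move=> jm; rewrite GmxE; exact: neumann_unit h0 d1 G0u (small _ jm).
have etaS j : (j < m.+1)%N -> eta j.+1 = H j *m eta j + r j.
  move=> jm; rewrite /H /r /truncation /Hmx -/h.
  by rewrite -[_ *m _ *m eta j]mulmxA -mulmxDr addrC subrK mulKmx ?Gu.
rewrite (duhamel eta0 etaS).
apply: le_trans (hnorm_sum _ _ _ (ltW h0)) _.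
have -> : Kp / (1 - delta) * m.+1%:R * R0
    = \sum_(0 <= j < m.+1) Kp * (R0 / (1 - delta)).
  by rewrite sumr_const_nat subn0 -[RHS]mulr_natl; ring.
rewrite !big_nat; apply: ler_sum => j /andP[_ jm].
apply: le_trans (hnorm_mulmx_le _ _ h0) _.
apply: ler_pM; rewrite ?opnorm_ge0 ?hnorm_ge0 //; first by apply: prodK; rewrite ltnS.
rewrite /r GmxE; apply: le_trans (neumann_inv _ h0 d1 G0u (small _ _)) _ => //.
by rewrite ler_wpM2r ?truncR // invr_ge0 subr_ge0 ltW.
Qed.

End ErrorRecursion.

Section Truncation.
Variables (R : realType) (n N : nat) (A B C0 D : 'M[R]_n).
Variable C1 : {linear 'cV[R]_n -> 'M[R]_n}.
Variable tau : R.
Let M := N.+1.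
Let h := mesh R M.
Local Notation stk w := (stack M w : 'cV[R]_(N * n)).

Lemma blk_Gmx (U : 'cV[R]_(N * n)) (w : nat -> 'cV[R]_n) i :
  w 0%N = 0 -> w M = 0 ->
  blk ((Gmx A B C0 D C1 tau (U : 'cV[R]_(M.-1 * n)) : 'M[R]_(N * n)) *m stk w) i =
  A *m (tau^-1 *: w i.+1)
  + B *m (h ^- 2 *: (w i - 2 *: w i.+1 + w i.+2))
  + Cof C0 C1 (blk U i) *m (h^-1 *: (w i.+2 - w i.+1)) + D *m w i.+1.
Proof.
move=> w0 wM; rewrite /Gmx !mulmxDl -!scalemxAl !blkD !blkZ.
have blkw k : blk (stk w) k = w k.+1 by exact: blk_stack.
rewrite !tens1E !blk_bdiag blkw blk_tens blk_btens -/h.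
congr (_ + _ + _ + _); first by rewrite -scalemxAl -scalemxAr.
- under eq_bigr => k _ do rewrite blkw scalemxAr.
  by rewrite -mulmx_sumr (lapP_sum i w0 wM) scalemxAr.
- under eq_bigr => k _ do rewrite blkw scalemxAr.
  by rewrite -mulmx_sumr (tilP_sum i wM) -mulmxDl scalemxAr.
Qed.

Variables (f : R -> R -> 'cV[R]_n) (u v : nat -> nat -> 'cV[R]_n).
Variables (vt vx vxx : nat -> nat -> 'cV[R]_n) (j : nat).
Hypothesis u_bd : u j.+1 0%N = 0 /\ u j.+1 M = 0.
Hypothesis v_bd : v j.+1 0%N = 0 /\ v j.+1 M = 0.
Hypothesis u_scheme : forall k, (1 <= k < M)%N -> scheme A B C0 D C1 f tau M u j k.
Hypothesis v_pde : forall k, (1 <= k < M)%N ->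
  A *m vt j.+1 k + B *m vxx j.+1 k + Cof C0 C1 (v j.+1 k) *m vx j.+1 k
  + D *m v j.+1 k = on_grid tau M f j.+1 k.

Definition time_defect k := tau^-1 *: (v j.+1 k - v j k) - vt j.+1 k.
Definition central_defect k :=
  h ^- 2 *: (v j.+1 k.-1 - 2 *: v j.+1 k + v j.+1 k.+1) - vxx j.+1 k.
Definition forward_diff k := h^-1 *: (v j.+1 k.+1 - v j.+1 k).

(** With d for the forward difference at level j + 1, C[u^j](dv - du) + C1[v^j - u^j] dv = C[v^j] dv
    - C[u^j] du, and the scheme removes the part in u. Replacing C[v^j] by C[v^(j+1)] produces the
    last term. *)
Lemma truncationE :
  (truncation A B C0 D C1 tau (fun j => stack M (u j)) (fun j => stack M (v j)) j
    : 'cV[R]_(N * n)) =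
  (1%:M *t A) *m stk time_defect + (1%:M *t B) *m stk central_defect
  + (E3mx C0 C1 (stack M (v j.+1)) : 'M[R]_(N * n))
      *m stk (fun k => forward_diff k - vx j.+1 k)
  - bdiag (fun i : 'I_N => C1 (v j.+1 i.+1 - v j i.+1)) *m stk forward_diff.
Proof.
case: u_bd v_bd => u0 uM [v0 vM].
have -> : truncation A B C0 D C1 tau (fun j => stack M (u j)) (fun j => stack M (v j)) j
  = Gmx A B C0 D C1 tau (stack M (u j)) *m stack M (v j.+1)
  - Gmx A B C0 D C1 tau (stack M (u j)) *m stack M (u j.+1)
  - (1%:M *t (tau^-1 *: A)) *m (stack M (v j) - stack M (u j))
  + h^-1 *: (btens (tilP R M.-1) C1 (stack M (v j) - stack M (u j)) *m stack M (v j.+1)).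
  rewrite /truncation CtilE [Gmx _ _ _ _ _ _ _ *m (_ - _)]mulmxBr.
  rewrite [(_ - _) *m _]mulmxBl -scalemxAl opprB.
  by rewrite -[RHS]addrA [- _ + _]addrC.
apply: blk_inj => i; rewrite !(blkD, blkN, blkZ).
have blks (w : nat -> 'cV[R]_n) k : blk (stk w) k = w k.+1 by exact: blk_stack.
rewrite !(blk_Gmx _ _ u0 uM) !(blk_Gmx _ _ v0 vM) /E3mx btens1E !tens1E !blk_bdiag.
rewrite blk_btens !blks !(blkD, blkN) !blks.
under eq_bigr => k _ do rewrite blks scalemxAr.
rewrite -mulmx_sumr (tilP_sum i vM).
have iM : (1 <= i.+1 < M)%N by exact: ltn_ord i.
have := u_scheme iM; have := v_pde iM; rewrite /scheme /= -/h.
rewrite /time_defect /central_defect -[h^-1 *: (v _ _ - _)]/(forward_diff i.+1).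
set dv := forward_diff i.+1.
have -> : h^-1 *: (C1 (v j i.+1 - u j i.+1) *m (v j.+1 i.+2 - v j.+1 i.+1))
    = C1 (v j i.+1) *m dv - C1 (u j i.+1) *m dv.
  by rewrite scalemxAr linearB mulmxBl.
have -> : tau^-1 *: A *m (v j i.+1 - u j i.+1)
    = A *m (tau^-1 *: v j i.+1) - A *m (tau^-1 *: u j i.+1).
  by rewrite mulmxBr -!scalemxAl !scalemxAr.
have -> : A *m (tau^-1 *: (u j.+1 i.+1 - u j i.+1))
    = A *m (tau^-1 *: u j.+1 i.+1) - A *m (tau^-1 *: u j i.+1).
  by rewrite scalerBr mulmxBr.
have -> : A *m (tau^-1 *: (v j.+1 i.+1 - v j i.+1) - vt j.+1 i.+1)
    = A *m (tau^-1 *: v j.+1 i.+1) - A *m (tau^-1 *: v j i.+1) - A *m vt j.+1 i.+1.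
  by rewrite mulmxBr scalerBr mulmxBr.
have -> : Cof C0 C1 (v j.+1 i.+1) *m (dv - vx j.+1 i.+1)
    = C0 *m dv + C1 (v j.+1 i.+1) *m dv - Cof C0 C1 (v j.+1 i.+1) *m vx j.+1 i.+1.
  by rewrite mulmxBr [in X in X - _ = _]/Cof mulmxDl.
have -> : C1 (v j.+1 i.+1 - v j i.+1) *m dv
    = C1 (v j.+1 i.+1) *m dv - C1 (v j i.+1) *m dv by rewrite linearB mulmxBl.
have -> : Cof C0 C1 (u j i.+1) *m dv = C0 *m dv + C1 (u j i.+1) *m dv.
  by rewrite /Cof mulmxDl.
rewrite mulmxBr /=.
set Bv := B *m (_ *: (v _ i - _ + _)); set Bu := B *m (_ *: (u _ i - _ + _)).
(* With all matrix products made opaque, the identity is a linear combination of the scheme and the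
   differential equation, entry by entry. *)
move: (on_grid _ _ _ _ _) (A *m vt _ _) (B *m vxx _ _) (Cof _ _ _ *m vx _ _) Bv Bu
  (Cof _ _ _ *m (_ *: (u _ _ - _))) (D *m u _ _) (D *m v _ _) (C0 *m dv)
  (C1 (u _ _) *m dv) (C1 (v j.+1 _) *m dv) (C1 (v j _) *m dv).
move: (A *m (_ *: u j.+1 _)) (A *m (_ *: u j _)) (A *m (_ *: v j.+1 _))
  (A *m (_ *: v j _)).
move=> a1 a2 a3 a4 F a5 b1 c1 b2 b3 c2 d1 d2 c3 c4 c5 c6 /matrixP pde /matrixP sch.
by apply/matrixP => k l; have := pde k l; have := sch k l; rewrite !mxE; lra.
Qed.

End Truncation.

Section TruncationBound.
Variables (R : realType) (n N : nat) (A B C0 D : 'M[R]_n).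
Variable C1 : {linear 'cV[R]_n -> 'M[R]_n}.
Variable tau : R.
Let M := N.+1.
Let h := mesh R M.
Local Notation stk w := (stack M w : 'cV[R]_(N * n)).
Local Notation G0 := (G0mx A B C0 D tau M : 'M[R]_(N * n)).
Local Notation Gk k := (G0k A B C0 D tau M k).
Hypothesis Gk_unit : forall k, (1 <= k < M)%N -> Gk k \in unitmx.

Let h_gt0 : 0 < h. Proof. by rewrite invr_gt0 ltr0n. Qed.

(** The weight h times the number N of interior nodes is at most 1, so pointwise bounds give
    mesh-independent norm bounds. *)
Lemma hnorm_stack_le (w : nat -> 'cV[R]_n) kap : 0 <= kap ->
  (forall k c, (1 <= k < M)%N -> `|w k c ord0| <= kap) ->
  hnorm h (stk w) <= Num.sqrt n%:R * kap.
Proof.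
move=> k0 wk; rewrite -(ger0_norm k0) -sqrtr_sqr -sqrtrM ?ler0n //.
rewrite hnorm_sqn ler_wsqrtr // sqn_blk.
have hN : h * N%:R <= 1.
  by rewrite /h /mesh ler_pdivrMl ?ltr0n // mulr1 ler_nat.
apply: (@le_trans _ _ (h * \sum_(i < N) n%:R * kap ^+ 2)).
  rewrite ler_pM2l //; apply: ler_sum => i _.
  have -> : n%:R * kap ^+ 2 = \sum_(c < n) kap ^+ 2 by rewrite sumr_const card_ord mulr_natl.
  have -> : blk (stk w) i = w i.+1 by exact: blk_stack.
  apply: ler_sum => c _; rewrite -real_normK ?num_real // lerXn2r ?nnegrE //.
  by apply: wk; exact: ltn_ord i.
rewrite sumr_const card_ord -[_ *+ N]mulr_natl [h * _]mulrA.
by rewrite ler_piMl // mulr_ge0 ?sqr_ge0.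
Qed.

Variables (u v vx vt vxx : nat -> nat -> 'cV[R]_n) (f : R -> R -> 'cV[R]_n).
Variables (d j : nat) (b : 'I_d -> 'cV[R]_n).

Lemma truncation_le (SA SB S3 c al k1 k2 k3 k4 : R) :
  (u j.+1 0%N = 0 /\ u j.+1 M = 0) -> (v j.+1 0%N = 0 /\ v j.+1 M = 0) ->
  (forall k, (1 <= k < M)%N -> scheme A B C0 D C1 f tau M u j k) ->
  (forall k, (1 <= k < M)%N ->
    A *m vt j.+1 k + B *m vxx j.+1 k + Cof C0 C1 (v j.+1 k) *m vx j.+1 k
    + D *m v j.+1 k = on_grid tau M f j.+1 k) ->
  [/\ 0 <= SA, 0 <= SB, 0 <= c & 0 <= al] ->
  [/\ 0 <= k1, 0 <= k2, 0 <= k3 & 0 <= k4] ->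
  (forall k l, (1 <= k < M)%N -> `|time_defect tau v vt j k l ord0| <= k1) ->
  (forall k l, (1 <= k < M)%N -> `|central_defect N v vxx j k l ord0| <= k2) ->
  (forall k l, (1 <= k < M)%N ->
    `|(forward_diff N v j k - vx j.+1 k) l ord0| <= k3) ->
  (forall k l, (1 <= k < M)%N -> `|forward_diff N v j k l ord0| <= k4) ->
  (forall k, (1 <= k < M)%N -> opnorm 1 (invmx (Gk k) *m A) <= SA) ->
  (forall k, (1 <= k < M)%N -> opnorm 1 (invmx (Gk k) *m B) <= SB) ->
  opnorm 1 (invmx G0 *m (E3mx C0 C1 (stack M (v j.+1)) : 'M[R]_(N * n))) <= S3 ->
  (forall k r, (1 <= k < M)%N -> opnorm 1 (invmx (Gk k) *m C1 (b r)) <= c) ->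
  (forall k, (1 <= k < M)%N -> exists a : 'I_d -> R,
     v j.+1 k - v j k = \sum_q a q *: b q /\ forall q, `|a q| <= al) ->
  hnorm h (invmx G0 *m (truncation A B C0 D C1 tau (fun j => stack M (u j))
      (fun j => stack M (v j)) j : 'cV[R]_(N * n)))
    <= Num.sqrt n%:R * (SA * k1 + SB * k2 + S3 * k3 + d%:R * (c * al) * k4).
Proof.
move=> ubd vbd sch pde [SA0 SB0 c0 al0] [k10 k20 k30 k40] t1 t2 t3 t4 SAP SBP S3P cP alP.
rewrite (truncationE ubd vbd sch pde).
have h0 := ltW h_gt0.
have op_le (Q : 'M[R]_(N * n)) (w : nat -> 'cV[R]_n) S kap :
    0 <= S -> opnorm 1 Q <= S -> 0 <= kap ->
    (forall k c, (1 <= k < M)%N -> `|w k c ord0| <= kap) ->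
    hnorm h (Q *m stk w) <= Num.sqrt n%:R * (S * kap).
  move=> S0 QS kap0 wkap; apply: le_trans (hnorm_mulmx_le _ _ h_gt0) _.
  rewrite opnorm_mesh // mulrCA; apply: ler_pM; rewrite ?opnorm_ge0 ?hnorm_ge0 //.
  exact: hnorm_stack_le.
rewrite mulmxBr !mulmxDr !mulrDr.
apply: le_trans (hnormD _ _ h0) _; rewrite hnormN; apply: lerD.
  apply: le_trans (hnormD _ _ h0) _; apply: lerD.
    apply: le_trans (hnormD _ _ h0) _; apply: lerD; rewrite mulmxA; apply: op_le => //.
      exact: (@opnorm_invG0_tens R n N A B C0 D tau Gk_unit A SA SA0 SAP).
    exact: (@opnorm_invG0_tens R n N A B C0 D tau Gk_unit B SB SB0 SBP).
  rewrite mulmxA; apply: op_le => //.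
  by apply: le_trans S3P; exact: opnorm_ge0.
rewrite (hnormE _ h0) [leRHS]mulrCA.
have alP' (i : 'I_N) : exists a : 'I_d -> R,
    v j.+1 i.+1 - v j i.+1 = \sum_q a q *: b q /\ forall q, `|a q| <= al.
  by apply: alP; exact: ltn_ord i.
have := hnorm_invG0_C1 Gk_unit (stk (forward_diff N v j)) c0 al0 cP alP'.
move/(ler_wpM2l (sqrtr_ge0 h)) => le1; apply: le_trans le1 _.
rewrite [leLHS]mulrCA -(hnormE _ h0) ler_wpM2l ?mulr_ge0 //.
exact: hnorm_stack_le.
Qed.

End TruncationBound.

Section GridTruncation.
Variables (R : realType) (n : nat) (A B C0 D : 'M[R]_n).
Variables (C1 : {linear 'cV[R]_n -> 'M[R]_n}) (te : R).
Variables (f : R -> R -> 'cV[R]_n) (phi : R -> 'cV[R]_n).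
Variables (v : R -> R -> 'cV[R]_n) (dv : nat -> nat -> R -> R -> 'cV[R]_n).
Variable t : R.
Hypothesis f_cont : {within [set p : R * R | (0 < p.1 <= te) && (0 <= p.2 <= 1)],
  continuous (fun p : R * R => f p.1 p.2)}.
Hypothesis v_smooth : smooth_upto 4 te v dv.
Hypothesis v_solves : solves_ibvp A B C0 D C1 te f phi v dv.
Hypothesis t_itv : 0 < t <= te.
Variable K : R.
Hypothesis K0 : 0 <= K.
Hypothesis dv_le : forall a b, (a + b <= 4)%N -> forall (s x : R) c,
  0 < s <= te -> 0 <= x <= 1 -> `|dv a b s x c ord0| <= K.
Variables (d : nat) (pt : 'I_d -> R * R) (P rho : R).
Let b r := dv 1 0 (pt r).1 (pt r).2.
Hypothesis pt_in : forall r, 0 < (pt r).1 < t /\ 0 < (pt r).2 < 1.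
Hypothesis b_span : forall s y : R, 0 < s < t -> 0 < y < 1 ->
  ((dv 1 0 s y)^T <= \matrix_r (b r)^T)%MS.
Hypothesis P0 : 0 <= P.
Hypothesis b_coord : forall (w : 'cV[R]_n) (L : R), (w^T <= \matrix_r (b r)^T)%MS ->
  (forall c, `|w c ord0| <= L) ->
  exists a : 'I_d -> R, [/\ w = \sum_q a q *: b q, forall q, `|a q| <= P * L
    & \sum_q `|a q| <= P * L].
Hypothesis rho0 : 0 < rho.
Hypothesis rho_pt : forall r,
  [/\ rho <= (pt r).1, rho <= t - (pt r).1, rho <= (pt r).2 & rho <= 1 - (pt r).2].
Hypothesis rho_P : P * (K * (rho + rho)) <= 2^-1.
Let Q := (Num.truncn (4 / rho)).+1.

(** In the last summand P K tau bounds the coordinates of a time increment of v, the square root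
    term times Z bounds |G_0k^-1 C1(b_r)|, the final K bounds the forward difference, and d is the
    number of the b_r. *)
Lemma grid_truncation_le tau M m (u : nat -> nat -> 'cV[R]_n) (SA SB S3 Z : R) :
  0 < tau < rho -> 4 <= rho * M%:R -> m.+1%:R * tau = t ->
  (forall k, (1 <= k < M)%N -> G0k A B C0 D tau M k \in unitmx) ->
  (forall j, (j <= m)%N -> u j.+1 0%N = 0 /\ u j.+1 M = 0) ->
  (forall j k, (j <= m)%N -> (1 <= k < M)%N -> scheme A B C0 D C1 f tau M u j k) ->
  [/\ 0 <= SA, 0 <= SB & 0 <= Z] ->
  (forall k, (1 <= k < M)%N -> opnorm 1 (invmx (G0k A B C0 D tau M k) *m A) <= SA) ->
  (forall k, (1 <= k < M)%N -> opnorm 1 (invmx (G0k A B C0 D tau M k) *m B) <= SB) ->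
  (forall j, (1 <= j < m.+2)%N -> opnorm 1 (invmx (G0mx A B C0 D tau M) *m
      E3mx C0 C1 (stack M (on_grid tau M v j))) <= S3) ->
  (forall j, (1 <= j < m.+2)%N -> opnorm 1 (invmx (G0mx A B C0 D tau M) *m
      E4mx C1 (stack M (on_grid tau M (dv 1 0)%N j))) <= Z) ->
  forall j, (j <= m)%N ->
  hnorm (mesh R M) (invmx (G0mx A B C0 D tau M) *m
      truncation A B C0 D C1 tau (fun j => stack M (u j))
        (fun j => stack M (on_grid tau M v j)) j)
    <= Num.sqrt n%:R * (SA * (K * tau) + SB * (2 * K * mesh R M ^+ 2)
        + S3 * (K * mesh R M)
        + d%:R * (2 * Num.sqrt (Q%:R * 11 ^+ Q) * Z * (P * (K * tau))) * K).
Proof.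
move=> /andP[tau0 taurho]; case: M => [|N] rhoM mt Gu ubd sch [SA0 SB0 Z0] SAP SBP S3P ZP j jm.
  by move: rhoM; rewrite mulr0 lern0.
set M := N.+1 in rhoM Gu ubd sch SAP SBP S3P ZP *; set h := mesh R M.
have M0 : 0 < M%:R :> R by rewrite ltr0n.
have h0 : 0 < h by rewrite invr_gt0.
have hM : M%:R * h = 1 by rewrite mulfV // gt_eqF.
have t0 : 0 < t by case/andP: t_itv.
have grid_t (q : nat) : (q <= m.+1)%N -> 0 <= q%:R * tau <= t.
  move=> qm; rewrite mulr_ge0 ?(ltW tau0) //= -mt.
  by rewrite ler_wpM2r ?ler_nat // ltW.
have grid_t1 (q : nat) : (q <= m)%N -> 0 < q.+1%:R * tau <= t.
  move=> qm; have /andP[_ ->] := grid_t q.+1 qm.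
  by rewrite mulr_gt0 ?ltr0n.
have grid_x (k : nat) : (k <= M)%N -> 0 <= k%:R * h <= 1.
  move=> kM; rewrite mulr_ge0 ?(ltW h0) //= -[leRHS]hM.
  by rewrite ler_wpM2r ?ler_nat // ltW.
have grid_x_in (k : nat) : (1 <= k < M)%N -> 0 < k%:R * h < 1.
  by move=> /andP[k1 kM]; rewrite mulr_gt0 ?ltr0n //= -[ltRHS]hM ltr_pM2r ?ltr_nat.
have xS (k : nat) : k.+1%:R * h = k%:R * h + h by rewrite -natr1; ring.
have tS : j.+1%:R * tau = j%:R * tau + tau by rewrite -natr1; ring.
pose vx := on_grid tau M (dv 0 1)%N; pose vxx := on_grid tau M (dv 0 2)%N.
have tj1 := grid_t1 j jm.
have tj1' : 0 <= j.+1%:R * tau <= t by exact: grid_t.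
have tj0 : 0 <= j%:R * tau <= t by apply: grid_t; exact: leqW.
have time_le k l : (1 <= k < M)%N ->
    `|time_defect tau (on_grid tau M v) (on_grid tau M (dv 1 0)%N) j k l ord0| <= K * tau.
  move=> /andP[_ /ltnW kM].
  have := time_taylor v_smooth v_solves t_itv K0 dv_le l tj0 tj1 (grid_x k kM).
  have -> : j%:R * tau - j.+1%:R * tau = - tau by rewrite tS; ring.
  rewrite normrN (gtr0_norm tau0) => le2.
  have -> : time_defect tau (on_grid tau M v) (on_grid tau M (dv 1 0)%N) j k l ord0
    = - tau^-1 * (v (j%:R * tau) (k%:R * h) l ord0 - v (j.+1%:R * tau) (k%:R * h) l ord0
        - - tau * dv 1%N 0%N (j.+1%:R * tau) (k%:R * h) l ord0).
    by rewrite !mxE /on_grid /= -?/M -?/h; field; rewrite gt_eqF.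
  rewrite normrM normrN [`|tau^-1|]gtr0_norm ?invr_gt0 // [leLHS]mulrC ler_pdivrMr //.
  by rewrite -[leRHS]mulrA -expr2.
have central_le k l : (1 <= k < M)%N ->
    `|central_defect N (on_grid tau M v) vxx j k l ord0| <= 2 * K * h ^+ 2.
  case: k => [//|k] /andP[_ kM].
  have kB : k.+1%:R * h - h = k%:R * h by rewrite xS; ring.
  have /andP[k0 _] := grid_x k (ltnW (ltnW kM)).
  have /andP[_ k2] := grid_x k.+2 kM.
  have := space_central v_smooth v_solves t_itv K0 dv_le l (x := k.+1%:R * h)
    (y := h) tj1.
  rewrite kB -xS => /(_ k0 (ltW h0) k2); rewrite (gtr0_norm h0) => le4.
  have -> : central_defect N (on_grid tau M v) vxx j k.+1 l ord0
    = h ^- 2 * (v (j.+1%:R * tau) (k%:R * h) l ord0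
        - 2 * v (j.+1%:R * tau) (k.+1%:R * h) l ord0
        + v (j.+1%:R * tau) (k.+2%:R * h) l ord0
        - h ^+ 2 * dv 0%N 2%N (j.+1%:R * tau) (k.+1%:R * h) l ord0).
    by rewrite !mxE /on_grid /= -/M -/h; field; rewrite gt_eqF.
  rewrite normrM [`|h ^- 2|]gtr0_norm ?invr_gt0 ?exprn_gt0 //.
  rewrite [leLHS]mulrC ler_pdivrMr ?exprn_gt0 //.
  by rewrite -[leRHS]mulrA -exprD.
have forward_le k l : (1 <= k < M)%N ->
    `|(forward_diff N (on_grid tau M v) j k - vx j.+1 k) l ord0| <= K * h.
  move=> /andP[_ kM].
  have := space_taylor v_smooth v_solves t_itv K0 dv_le l tj1
    (grid_x k (ltnW kM)) (grid_x k.+1 kM).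
  have -> : k.+1%:R * h - k%:R * h = h by rewrite xS; ring.
  rewrite (gtr0_norm h0) => le2.
  have -> : (forward_diff N (on_grid tau M v) j k - vx j.+1 k) l ord0
    = h^-1 * (v (j.+1%:R * tau) (k.+1%:R * h) l ord0
        - v (j.+1%:R * tau) (k%:R * h) l ord0
        - h * dv 0%N 1%N (j.+1%:R * tau) (k%:R * h) l ord0).
    by rewrite !mxE /on_grid /= -?/M -?/h; field; rewrite gt_eqF.
  rewrite normrM [`|h^-1|]gtr0_norm ?invr_gt0 // [leLHS]mulrC ler_pdivrMr //.
  by rewrite -[leRHS]mulrA -expr2.
have diff_le k l : (1 <= k < M)%N ->
    `|forward_diff N (on_grid tau M v) j k l ord0| <= K.
  move=> /andP[_ kM].
  have := space_lipschitz v_smooth v_solves t_itv K0 dv_le l tj1'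
    (grid_x k (ltnW kM)) (grid_x k.+1 kM).
  have -> : k.+1%:R * h - k%:R * h = h by rewrite xS; ring.
  rewrite (gtr0_norm h0) => le1.
  by rewrite !mxE normrM gtr0_norm ?invr_gt0 // [leLHS]mulrC ler_pdivrMr.
have C1b : forall k r, (1 <= k < M)%N ->
    opnorm 1 (invmx (G0k A B C0 D tau M k) *m C1 (b r))
      <= 2 * Num.sqrt (Q%:R * 11 ^+ Q) * Z.
  have NQ (r : 'I_d) : (N.+1 <= Q * Num.truncn (rho * M%:R / 2))%N.
    by case: (rho_pt r) => _ _ r3 r4; case: (space_near rho0 rhoM r3 r4).
  move=> k r kM; have tau_rho : 0 < tau < rho by rewrite tau0.
  apply: (invG0k_le_invG0_E4 (C1 := C1) (m := m) (w := on_grid tau M (dv 1 0)%N)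
    Gu (NQ r) Z0 ZP _ r kM) => q.
  have [r1 r2 r3 r4] := rho_pt q.
  have [jq [jq_in jq_near jq_t]] := time_near tau_rho mt r1 r2.
  have [_ [a [a0 aM a_near]]] := space_near rho0 rhoM r3 r4.
  exists jq, a; split=> // l l_in.
  have lM : (1 <= l < M)%N by rewrite (leq_trans a0) ?(leq_trans _ aM); case/andP: l_in.
  have jq0 : 0 < jq%:R * tau < t.
    by rewrite jq_t andbT mulr_gt0 // ltr0n; case/andP: jq_in.
  have [qt qx] := pt_in q.
  have te_in (s : R) : 0 < s < t -> 0 < s < te.
    by case/andP: t_itv => _ tte /andP[-> /lt_le_trans ->].
  (* The value of v_t at the node and b_q both lie in the span and differ entrywise by at most K
     (rho + rho), so [rho_P] bounds the sum of the coordinates of their difference by 1/2. *)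
  have diff_in : ((dv 1 0 (jq%:R * tau) (l%:R * h) - b q)^T <= \matrix_r (b r)^T)%MS.
    rewrite linearB addmx_sub ?b_span ?grid_x_in // -scaleN1r scalemx_sub //.
    exact: b_span.
  have [c|al [alE _ al_sum]] := b_coord diff_in (L := K * (rho + rho)).
    have := dv10_lipschitz v_smooth K0 dv_le c
      (te_in _ qt) (te_in _ jq0) qx (grid_x_in l lM).
    rewrite mxE [(- _ : 'cV_n) _ _]mxE => le1; apply: le_trans le1 _.
    by rewrite ler_wpM2l // lerD // ?(ltW jq_near) // a_near.
  exists al; split; last exact: le_trans al_sum rho_P.
  by rewrite -alE addrC subrK.
have vbd : on_grid tau M v j.+1 0%N = 0 /\ on_grid tau M v j.+1 M = 0.
  have [v0 v1] := boundary_closed v_solves t_itv tj1.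
  by rewrite /on_grid mul0r -/h hM.
have pde k : (1 <= k < M)%N ->
    A *m on_grid tau M (dv 1 0)%N j.+1 k + B *m vxx j.+1 k
    + Cof C0 C1 (on_grid tau M v j.+1 k) *m vx j.+1 k + D *m on_grid tau M v j.+1 k
    = on_grid tau M f j.+1 k.
  move=> /andP[_ /ltnW kM].
  exact: (pde_closed f_cont v_smooth v_solves t_itv tj1 (grid_x k kM)).
have PKt0 : 0 <= P * (K * tau) by rewrite !mulr_ge0 ?(ltW tau0).
apply: (truncation_le Gu (ubd j jm) vbd (fun k => sch j k jm) pde _ _
  time_le central_le forward_le diff_le SAP SBP _ C1b).
- by split=> //; rewrite !mulr_ge0 ?sqrtr_ge0.
- by rewrite !mulr_ge0 ?exprn_ge0 ?(ltW tau0) ?(ltW h0).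
- by apply: S3P; rewrite ltn0Sn ltnS.
move=> k /andP[_ /ltnW kM].
have inc := increment_in_span v_smooth v_solves t_itv b_span tj0 tj1' (grid_x k kM).
have [l|a [aE aP _]] := b_coord inc (L := K * tau).
  have := time_lipschitz v_smooth v_solves t_itv K0 dv_le l tj0 tj1' (grid_x k kM).
  have -> : j.+1%:R * tau - j%:R * tau = tau by rewrite tS; ring.
  by rewrite (gtr0_norm tau0) !mxE.
by exists a.
Qed.

End GridTruncation.

(** * Choice of the constants and conclusion *)

Lemma G0mx_unit (R : realType) n (A B C0 D : 'M[R]_n) (tau : R) M : (0 < M)%N ->
  (forall k, (1 <= k < M)%N -> G0k A B C0 D tau M k \in unitmx) ->
  G0mx A B C0 D tau M \in unitmx.
Proof. by case: M => // N _ Gu; case: (G0mx_inv Gu). Qed.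

(** The reciprocal of a sum of nonnegative terms lies below the reciprocal of each positive one: the
    terms 1 / gap give the distances to the boundary, 2 L gives the bound 1/2, and 1 keeps the sum
    positive when d = 0 and L = 0. *)
Lemma common_radius (R : realType) (d : nat) (g : 'I_d -> R * R) (t L : R) :
  (forall r, 0 < (g r).1 < t /\ 0 < (g r).2 < 1) -> 0 <= L ->
  exists2 rho : R, 0 < rho & L * rho <= 2^-1 /\ forall r,
    [/\ rho <= (g r).1, rho <= t - (g r).1, rho <= (g r).2 & rho <= 1 - (g r).2].
Proof.
move=> g_in L0.
pose gap r : R := Num.min (Num.min (g r).1 (t - (g r).1))
                          (Num.min (g r).2 (1 - (g r).2)).
have gap0 r : 0 < gap r.
  have [/andP[g1 g1t] /andP[g2 g21]] := g_in r.
  by rewrite !lt_min g1 g2 !subr_gt0 g1t g21.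
have S0 : 0 <= \sum_r (gap r)^-1 by apply: sumr_ge0 => r _; rewrite invr_ge0 ltW.
have D0 : 0 < 1 + 2 * L + \sum_r (gap r)^-1 by lra.
exists (1 + 2 * L + \sum_r (gap r)^-1)^-1; first by rewrite invr_gt0.
split; first by rewrite ler_pdivrMr //; lra.
move=> r; have : (1 + 2 * L + \sum_r (gap r)^-1)^-1 <= gap r.
  rewrite -[leRHS]invrK lef_pV2 ?posrE ?invr_gt0 //.
  rewrite (bigD1 r) //= [_^-1 + _]addrC addrA lerDr.
  by rewrite !addr_ge0 ?mulr_ge0 // sumr_ge0 // => q _; rewrite invr_ge0 ltW.
by rewrite !le_min => /andP[/andP[-> ->] /andP[-> ->]].
Qed.

Unset Implicit Arguments.

Theorem lemma11 (R : realType) (n : nat) (A B C0 D : 'M[R]_n)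
  (C1 : {linear 'cV[R]_n -> 'M[R]_n})
  (te : R) (f : R -> R -> 'cV[R]_n) (phi : R -> 'cV[R]_n)
  (v : R -> R -> 'cV[R]_n) (dv : nat -> nat -> R -> R -> 'cV[R]_n)
  (t : R) (m M : nat -> nat) (tau : nat -> R)
  (u : nat -> nat -> nat -> 'cV[R]_n) :
  let h i := mesh R (M i) in
  let U i j := stack (M i) (u i j) in
  let V i j := stack (M i) (on_grid (tau i) (M i) v j) in
  let Vt i j := stack (M i) (on_grid (tau i) (M i) (dv 1%N 0%N) j) in
  let eta i j := V i j - U i j in
  let nrm i := @opnorm R (h i) ((M i).-1 * n) in
  let G0 i := G0mx A B C0 D (tau i) (M i) in
  let G1 i j := G1mx C0 C1 (U i j) in
  let G0_ i k := G0k A B C0 D (tau i) (M i) k in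
  let H i j := Hmx A B C0 D C1 (tau i) (U i j) (V i j.+1) in
  let C w := Cof C0 C1 w in
  (* data *)
  A != 0 -> B != 0 -> 0 < te ->
  {within [set p : R * R | (0 < p.1 <= te) && (0 <= p.2 <= 1)],
    continuous (fun p : R * R => f p.1 p.2)} ->
  (* exact solution *)
  smooth_upto 4 te v dv ->
  solves_ibvp A B C0 D C1 te f phi v dv ->
  (* refinement: t fixed, tau -> 0, h -> 0 *)
  0 < t <= te ->
  (forall i, (m i).+1%:R * tau i = t) ->
  (forall i, (2 <= M i)%N) ->
  tau @ \oo --> 0 -> h @ \oo --> 0 ->
  (* numerical solution *)
  (forall i k, (1 <= k < M i)%N -> u i 0%N k = phi (k%:R * h i)) ->
  (forall i j, (j <= m i)%N -> u i j.+1 0%N = 0 /\ u i j.+1 (M i) = 0) ->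
  (forall i j k, (j <= m i)%N -> (1 <= k < M i)%N ->
    scheme A B C0 D C1 f (tau i) (M i) (u i) j k) ->
  (forall i k, (1 <= k < M i)%N -> G0_ i k \in unitmx) ->
  (* conditions 4, 5, 6 *)
  (forall i j, (1 <= j <= m i)%N -> ((hnorm (h i) (U i j))%:E < +oo)%E) ->
  (forall i, hnorm (h i) (eta i 0%N) = 0) ->
  has_ubound [set y | exists i j, (1 <= j <= m i)%N /\
    y = nrm i (\big[mulmx/1%:M]_(l <- rev (index_iota j (m i).+1)) H i l)] ->
  exists K1 : R, 0 < K1 /\
  exists oA oB o3 o4 o4' : nat -> R,
    [/\ isO oA tau, isO oB (fun i => h i ^+ 2), isO o3 h, isO o4 tau
      & isO o4' (fun i => tau i * h i)] /\
  forall delta0 : R, 0 < delta0 < 1 ->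
  (* condition 7 *)
  (forall i j, (j <= m i)%N ->
    let bound :=
      (\big[Num.max/0]_(1 <= k < M i) specnorm (invmx (G0_ i k))) * (h i)^-1 *
      (\big[Num.max/0]_(1 <= k < M i) specnorm (C1 (u i j k)) +
       \big[Num.max/0]_(1 <= k < (M i).-1) specnorm (C (u i j k))) in
    nrm i (invmx (G0 i)) * nrm i (G1 i j) <= bound /\ bound <= delta0) ->
  forall i,
    hnorm (h i) (eta i (m i).+1) <=
    K1 / (1 - delta0) * (t / tau i) *
    (\big[Num.max/0]_(1 <= k < M i)
       (specnorm (invmx (G0_ i k) *m A) * oA i +
        specnorm (invmx (G0_ i k) *m B) * oB i) +
     \big[Num.max/0]_(1 <= j < (m i).+2)
       (nrm i (invmx (G0 i) *m E3mx C0 C1 (V i j)) * o3 i +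
        nrm i (invmx (G0 i) *m E4mx C1 (Vt i j)) * (o4 i + o4' i))).
Proof.
move=> h U V Vt eta nrm G0 G1 G0_ H C A0 B0 te0 f_cont v_smooth v_solves t_itv mt M2
  tau_cvg h_cvg u_init u_bd u_scheme Gu _ eta0 [Kub KubP].
have [K K0 dv_le] := dv_bounded v_smooth.
have t0 : 0 < t by case/andP: t_itv.
have tau0 i : 0 < tau i by rewrite -(pmulr_rgt0 _ (ltr0Sn R (m i))) mt.
have M0 i : (0 < M i)%N by exact: ltnW.
have h0 i : 0 < h i by rewrite invr_gt0 ltr0n.
have [d [pt [pt_in b_span]]] := @spanning_family R (R * R)%type n
  (fun p => 0 < p.1 < t /\ 0 < p.2 < 1) (fun p => (dv 1 0 p.1 p.2)^T)%N.
pose b r := dv 1%N 0%N (pt r).1 (pt r).2.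
have [P P0 b_coord] := span_coordinates b.
have PK0 : 0 <= P * (K * 2) by rewrite !mulr_ge0.
have [rho rho0 [rho_P rho_pt]] := common_radius pt_in PK0.
pose Cq : R := 2 * Num.sqrt ((Num.truncn (4 / rho)).+1%:R * 11 ^+ (Num.truncn (4 / rho)).+1).
have Cq0 : 0 <= Cq by rewrite mulr_ge0 ?sqrtr_ge0.
pose sn : R := Num.sqrt n%:R.
have sn0 : 0 <= sn by exact: sqrtr_ge0.
pose c4 : R := sn * (d%:R * (Cq * (P * K)) * K).
have c40 : 0 <= c4 by rewrite !mulr_ge0.
(* [c0] dominates sn K, 2 sn K and c4, the constants of the four terms in [grid_truncation_le]; each
   term will then be at most [RAB] or [R34]. *)
pose c0 : R := 1 + sn * (2 * K) + c4.
have snK0 : 0 <= sn * (2 * K) by rewrite !mulr_ge0.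
have c0_gt0 : 0 < c0 by rewrite /c0; lra.
have [i0 i0P] : exists i0, forall i, (i0 <= i)%N -> tau i < rho /\ 4 <= rho * (M i)%:R.
  have : \forall i \near \oo, tau i < rho /\ h i < rho / 4.
    near=> i; split.
      have : `|0 - tau i| < rho by near: i; exact: cvgr_dist_lt.
      by rewrite sub0r normrN gtr0_norm.
    have : `|0 - h i| < rho / 4.
      by near: i; apply: cvgr_dist_lt => //; rewrite divr_gt0.
    by rewrite sub0r normrN gtr0_norm.
  move=> [i0 _ i0P]; exists i0 => i /i0P [ti hi]; split=> //.
  have Mi : 0 < (M i)%:R :> R by rewrite ltr0n.
  have : h i * (M i)%:R <= rho / 4 * (M i)%:R by rewrite ler_wpM2r // ltW.
  by rewrite /h /mesh mulVf ?gt_eqF //; lra.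
pose Tr i j := hnorm (h i) (invmx (G0 i) *m truncation A B C0 D C1 (tau i) (U i) (V i) j).
pose SA1 i := specnorm (invmx (G0_ i 1%N) *m A).
have SA1_gt0 i : 0 < SA1 i.
  rewrite lt_def opnorm_ge0 // andbT; apply/eqP => /(opnorm_eq0 ltr01) GA.
  move/eqP: A0; apply.
  by rewrite -[A](mulKVmx (Gu i 1%N (M2 i))) GA mulmx0.
(* For the finitely many coarse grids the constant of oA is enlarged, which
   works because A != 0 makes |G01^-1 A| positive. *)
pose X i := \sum_(j < (m i).+1) Tr i j / (SA1 i * tau i).
have X0 i : 0 <= X i.
  by apply: sumr_ge0 => j _; rewrite divr_ge0 ?hnorm_ge0 // mulr_ge0 // ltW.
pose cA := c0 + \sum_(i < i0) X i.
have c0A : c0 <= cA by rewrite lerDl sumr_ge0.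
have cA_gt0 : 0 < cA by exact: lt_le_trans c0A.
(* The Duhamel sum also contains the empty product, of norm at most 1, which condition 6 does not
   list; the maximum makes [Kp] positive as well. *)
pose Kp := Num.max Kub 1.
have Kp0 : 0 < Kp by rewrite lt_max ltr01 orbT.
exists (4 * Kp); split; first by rewrite mulr_gt0.
(* The tau h term gets the witness 0: the forward difference in the C1 contribution is bounded as a
   whole, so this contribution is already of order tau. *)
exists (fun i => cA * tau i), (fun i => c0 * h i ^+ 2), (fun i => c0 * h i),
  (fun i => c0 * tau i), (fun=> 0); split.
  split; [exists cA|exists c0|exists c0|exists c0|exists 0] => i;
    by rewrite ?mul0r ?lexx ?andbT ?mulr_ge0 ?exprn_ge0 // ltW.
move=> delta0 /andP[delta0_gt0 delta0_lt1] cond7 i.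
set RAB := \big[Num.max/0]_(1 <= k < M i) _.
set R34 := \big[Num.max/0]_(1 <= j < (m i).+2) _.
have RAB0 : 0 <= RAB by exact: bigmax_nat_ge0.
have R340 : 0 <= R34 by exact: bigmax_nat_ge0.
have RAB_ge k : (1 <= k < M i)%N -> specnorm (invmx (G0_ i k) *m A) * (cA * tau i)
    + specnorm (invmx (G0_ i k) *m B) * (c0 * h i ^+ 2) <= RAB.
  by move=> kM; exact: (@le_bigmax_nat_at R (fun k => specnorm (invmx (G0_ i k) *m A) * (cA * tau i)
    + specnorm (invmx (G0_ i k) *m B) * (c0 * h i ^+ 2)) 1 (M i) k).
have R34_ge j : (1 <= j < (m i).+2)%N ->
    nrm i (invmx (G0 i) *m E3mx C0 C1 (V i j)) * (c0 * h i)
    + nrm i (invmx (G0 i) *m E4mx C1 (Vt i j)) * (c0 * tau i + 0) <= R34.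
  by move=> jm; exact: (@le_bigmax_nat_at R (fun j =>
    nrm i (invmx (G0 i) *m E3mx C0 C1 (V i j)) * (c0 * h i)
    + nrm i (invmx (G0 i) *m E4mx C1 (Vt i j)) * (c0 * tau i + 0)) 1 (m i).+2 j).
have ge0_mul x (Q : 'M[R]_n) : 0 < x -> 0 <= specnorm Q * x.
  by move=> x0; rewrite mulr_ge0 ?opnorm_ge0 // ltW.
have cAt : 0 < cA * tau i by rewrite mulr_gt0.
have c0t : 0 < c0 * tau i by rewrite mulr_gt0.
have c0h : 0 < c0 * h i by rewrite mulr_gt0.
have c0h2 : 0 < c0 * h i ^+ 2 by rewrite mulr_gt0 ?exprn_gt0.
have TrR j : (j <= m i)%N -> Tr i j <= 4 * (RAB + R34).
  move=> jm; have [ii0|i0i] := ltnP i i0.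
    (* Coarse grid: the entry k = 1 of the maximum [RAB] suffices, since [cA] contains Tr i j / (SA1
       i tau i) as a summand. *)
    apply: (@le_trans _ _ RAB); last by lra.
    apply: le_trans (RAB_ge 1%N (M2 i)); rewrite -[Tr i j]addr0.
    apply: lerD; last exact: ge0_mul.
    rewrite -/(SA1 i) mulrCA -ler_pdivrMr; last by rewrite mulr_gt0.
    apply: (@le_trans _ _ (X i)).
      have jm' : (j < (m i).+1)%N by [].
      rewrite /X (bigD1 (Ordinal jm')) //= lerDl sumr_ge0 // => q _.
      by rewrite divr_ge0 ?hnorm_ge0 // mulr_ge0 // ltW.
    rewrite /cA (bigD1 (Ordinal ii0)) //= addrCA lerDl addr_ge0 ?(ltW c0_gt0) //.
    exact: sumr_ge0.
  have [tau_rho M_rho] := i0P _ i0i.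
  have span_b s y : 0 < s < t -> 0 < y < 1 -> ((dv 1 0 s y)^T <= \matrix_r (b r)^T)%MS.
    by move=> st y01; exact: (b_span (s, y)).
  have rho_P' : P * (K * (rho + rho)) <= 2^-1.
    by apply: le_trans rho_P; rewrite le_eqVlt; apply/orP; left; apply/eqP; ring.
  have tau_in : 0 < tau i < rho by rewrite tau0.
  (* Each operator norm is at most [RAB] or [R34] divided by its own weight. These quotients serve
     as SA, SB, S3 and Z, and the step sizes in them cancel against those in the conclusion. *)
  have := @grid_truncation_le R n A B C0 D C1 te f phi v dv t f_cont v_smooth v_solves
    t_itv K K0 dv_le d pt P rho pt_in span_b P0 b_coord rho0 rho_pt rho_P' (tau i)
    (M i) (m i) (u i) (RAB / (cA * tau i)) (RAB / (c0 * h i ^+ 2)) (R34 / (c0 * h i))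
    (R34 / (c0 * tau i)) tau_in M_rho (mt i) (Gu i) (u_bd i) (u_scheme i).
  move=> le; apply: le_trans (le _ _ _ _ _ j jm) _.
  - by rewrite !divr_ge0 // ltW.
  - move=> k kM; rewrite ler_pdivlMr //; apply: le_trans (RAB_ge k kM).
    by rewrite lerDl ge0_mul.
  - move=> k kM; rewrite ler_pdivlMr //; apply: le_trans (RAB_ge k kM).
    by rewrite lerDr ge0_mul.
  - move=> q qm; rewrite ler_pdivlMr // -(opnorm_mesh _ (h0 i)).
    apply: le_trans (R34_ge q qm); rewrite lerDl addr0.
    by rewrite mulr_ge0 ?opnorm_ge0 ?(ltW c0t).
  - move=> q qm; rewrite ler_pdivlMr // -(opnorm_mesh _ (h0 i)).
    apply: le_trans (R34_ge q qm); rewrite addr0 lerDr.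
    by rewrite mulr_ge0 ?opnorm_ge0 ?(ltW c0h).
  rewrite -/(h i) -/sn -/Cq.
  have -> : sn * (RAB / (cA * tau i) * (K * tau i)
      + RAB / (c0 * h i ^+ 2) * (2 * K * h i ^+ 2) + R34 / (c0 * h i) * (K * h i)
      + d%:R * (Cq * (R34 / (c0 * tau i)) * (P * (K * tau i))) * K)
    = sn * K / cA * RAB + sn * (2 * K) / c0 * RAB + sn * K / c0 * R34 + c4 / c0 * R34.
    by rewrite /c4; field; rewrite !gt_eqF.
  have frac_le (x y z : R) : x <= y -> 0 < y -> 0 <= z -> x / y * z <= z.
    by move=> xy y0 z0; rewrite ler_piMl // ler_pdivrMr // mul1r.
  have snK : sn * (2 * K) = 2 * (sn * K) by ring.
  have snK1 : 0 <= sn * K by rewrite mulr_ge0.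
  have le1 : sn * K / cA * RAB <= RAB.
    by apply: frac_le => //; apply: le_trans c0A; rewrite /c0; lra.
  have le2 : sn * (2 * K) / c0 * RAB <= RAB by apply: frac_le => //; rewrite /c0; lra.
  have le3 : sn * K / c0 * R34 <= R34 by apply: frac_le => //; rewrite /c0; lra.
  have le4 : c4 / c0 * R34 <= R34 by apply: frac_le => //; rewrite /c0; lra.
  by lra.
have t_tau : t / tau i = (m i).+1%:R by rewrite -(mt i) mulfK // gt_eqF.
have prodK j : (1 <= j <= (m i).+1)%N ->
    opnorm (h i) (\big[mulmx/1%:M]_(l <- rev (index_iota j (m i).+1)) H i l) <= Kp.
  move=> /andP[j1]; rewrite leq_eqVlt => /orP[/eqP ->|jm].
    rewrite /index_iota subnn big_nil; apply: le_trans (opnorm1_le _ _) _.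
    by rewrite le_max lexx orbT.
  rewrite le_max; apply/orP; left; apply: KubP; exists i, j; split=> //.
  by rewrite j1 -ltnS.
have small j : (j <= m i)%N -> nrm i (invmx (G0 i)) * nrm i (G1 i j) <= delta0.
  by move=> jm; have [le1 le2] := cond7 i j jm; exact: le_trans le1 le2.
have eta00 : eta i 0%N = 0 by apply/eqP; rewrite -(hnorm_eq0 _ (h0 i)) eta0.
have := @error_bound R n A B C0 D C1 (tau i) (M i) (U i) (V i) (m i) Kp
  (4 * (RAB + R34)) delta0 (M0 i) eta00 (ltW Kp0) (G0mx_unit (M0 i) (Gu i)) delta0_lt1
  small prodK TrR.
move=> bound; apply: le_trans bound _; rewrite t_tau le_eqVlt.
by apply/orP; left; apply/eqP; ring.
Unshelve. all: by end_near.
Qed.
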